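(* Let $d\in\mathbb{N}$ with $d>1$ and $0<T<\infty$. Then the stochastic current of Brownian motion at $x=0\in\mathbb{R}^d$, \[ \xi(0)=\left(\int_{0}^{T}\delta(B(t))\Diamond W_{1}(t)\,\mathrm{d}t,\ldots,\int_{0}^{T}\delta(B(t))\Diamond W_{d}(t)\,\mathrm{d}t\right), \] is not a Hida distribution. Here ''$\xi(0)$ is a Hida distribution'' means that for every $i\in\{1,\ldots,d\}$ the integral $\int_{0}^{T}\delta(B(t))\Diamond W_{i}(t)\,\mathrm{d}t$ exists as a Bochner integral in some Hilbert subspace of $(S_d)'$.
   Context: Spaces. $S_d=S(\mathbb{R},\mathbb{R}^d)$ is the space of $\mathbb{R}^d$-valued Schwartz functions on $\mathbb{R}$, $S_d'$ its topological dual, $L^2_d=L^2(\mathbb{R},\mathbb{R}^d)$ with norm $|f|^2=\sum_{j=1}^d\int_{\mathbb{R}}|f_j(u)|^2\,\mathrm{d}u$; $V_{\mathbb{C}}$ denotes the complexification of $V$, $\langle\cdot,\cdot\rangle$ the bilinear dual pairing extending the real $L^2$ inner product, and $\hat\otimes n$ the symmetric $n$-th tensor power. $\mu_d$ is the white noise measure: the unique probability measure on the cylinder $\sigma$-algebra of $S_d'$ with $\int_{S_d'}e^{i\langle w,\varphi\rangle}\,\mathrm{d}\mu_d(w)=e^{-|\varphi|^2/2}$ for $\varphi\in S_d$. Every $F\in L^2(\mu_d)$ (complex valued) has a Wiener-Itô-Segal decomposition $F(w)=\sum_{n\ge0}\langle :w^{\otimes n}:,F_n\rangle$ with $F_n\in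 (L^2_{d,\mathbb{C}})^{\hat\otimes n}$, where $:w^{\otimes n}:$ is the $n$-th Wick power of $w$. Hida spaces. $(S_d)\subset L^2(\mu_d)\subset (S_d)'$ is the standard Gel'fand triple of Hida test functions and Hida distributions. Concretely, with $A=-\frac{\mathrm{d}^2}{\mathrm{d}u^2}+u^2+1$ acting componentwise, $(S_d)$ is the projective limit over $p\in\mathbb{N}_0$ of the Hilbert spaces $(S_d)_p$ of those $F\in L^2(\mu_d)$ with $\|F\|_p^2=\sum_n n!\,|(A^{\otimes n})^pF_n|^2<\infty$, and $(S_d)'=\bigcup_p (S_d)_{-p}$ is its dual, $(S_d)_{-p}$ being the dual of $(S_d)_p$. The bilinear dual pairing $\langle\!\langle\cdot,\cdot\rangle\!\rangle$ satisfies $\langle\!\langle F,\varphi\rangle\!\rangle=\sum_n n!\langle F_n,\varphi_n\rangle$ for $F\in L^2(\mu_d)$, $\varphi\in(S_d)$. A Hilbert subspace of $(S_d)'$ is a Hilbert space continuously embedded in $(S_d)'$ (such as some $(S_d)_{-p}$). $S$-transform. For $\Phi\in(S_d)'$ and $\varphi\in S_d$, $S\Phi(\varphi)=\langle\!\langle\Phi,e_{\mu_d}(\cdot,\varphi)\rangle\!\rangle$, where $e_{\mu_d}(\cdot,\varphi)=e^{\langle\cdot,\varphi\rangle-|\varphi|^2/2}=\sum_n\frac1{n!}\langle :\cdot^{\otimes n}:,\varphi^{\otimes n}\rangle\in(S_d)$. The $S$-transform is injective on $(S_d)'$, and for $\Phi,\Psi\in(S_d)'$ the Wick product $\Phi\Diamond\Psi\in(S_d)'$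 is the unique element with $S(\Phi\Diamond\Psi)=S\Phi\cdot S\Psi$. Processes. $\eta_t=1\!\!1_{[0,t)}$ and $\langle\eta_t,\varphi\rangle=\big(\int_0^t\varphi_1(u)\,\mathrm{d}u,\ldots,\int_0^t\varphi_d(u)\,\mathrm{d}u\big)\in\mathbb{R}^d$. $d$-dimensional Brownian motion is $B(t,w)=(\langle w_1,\eta_t\rangle,\ldots,\langle w_d,\eta_t\rangle)$, $t\ge0$. White noise $W(t)=(W_1(t),\ldots,W_d(t))$ is its derivative as an $(S_d)'$-valued process, with $SW_i(t)(\varphi)=\varphi_i(t)$. For $t>0$, Donsker's delta function $\delta(B(t))=\frac{1}{(2\pi)^d}\int_{\mathbb{R}^d}e^{-i(\lambda,B(t))_{\mathbb{R}^d}}\,\mathrm{d}\lambda$ (Bochner integral) is the element of $(S_d)'$ with $S\delta(B(t))(\varphi)=(2\pi t)^{-d/2}\exp\big(-\frac{1}{2t}|\langle\eta_t,\varphi\rangle|^2_{\mathbb{R}^d}\big)$. *)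

(* Defs.v *)
From HB Require Import structures.
From mathcomp Require Import all_boot all_order all_algebra perm sesquilinear.
From mathcomp Require Import complex.
From mathcomp Require Import all_classical all_reals all_analysis.

Set Implicit Arguments.
Unset Strict Implicit.
Unset Printing Implicit Defensive.

Import Order.TTheory GRing.Theory Num.Theory.
Import numFieldNormedType.Exports.

Local Open Scope classical_set_scope.
Local Open Scope ring_scope.
Local Open Scope complex_scope.

(* An R^d-valued function is the family [phi i u] of its components. *)
Definition schwartz_fun (R : realType) (f : R -> R) : Prop :=
  (forall n u, derivable (derive1n n f) u 1) /\
  (forall k n, exists M, forall u, `|u ^+ k * derive1n n f u| <= M).

Lemma derive1n_lin (R : realType) (a : R) (f g : R -> R) :
  schwartz_fun f -> schwartz_fun g ->
  forall n, derive1n n (a *: f + g) = a *: derive1n n f + derive1n n g.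
Proof.
move=> [fd _] [gd _]; elim=> [//|n IH].
rewrite !derive1nS IH; apply/funext => u.
rewrite fctE derive1E deriveD; [|exact: derivableZ|exact: gd].
by rewrite deriveZ // -!derive1E.
Qed.

Definition schwartz_pred (R : realType) (d : nat) : {pred 'I_d -> R -> R} :=
  fun phi => `[< forall i, schwartz_fun (phi i) >].

Lemma schwartz_submod_closed (R : realType) (d : nat) :
  submod_closed (@schwartz_pred R d).
Proof.
have lin (a : R) f g : schwartz_fun f -> schwartz_fun g ->
    schwartz_fun (a *: f + g).
  move=> fS gS; have E := derive1n_lin a fS gS.
  case: fS gS => [fd fb] [gd gb]; split=> [n u|k n]; rewrite E.
    by apply: derivableD => //; exact: derivableZ.
  have [M fM] := fb k n; have [N gN] := gb k n.
  exists (`|a| * M + N) => u /=.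
  rewrite mulrDr (le_trans (ler_normD _ _)) // lerD // mulrCA normrM.
  exact: ler_wpM2l.
have s0 : schwartz_fun (0 : R -> R).
  have E n : derive1n n (0 : R -> R) = 0.
    elim: n => // n IH; rewrite derive1nS IH; apply/funext => u.
    exact: derive1_cst.
  split=> [n u|k n]; rewrite E; first exact: derivable_cst.
  by exists 0 => u; rewrite mulr0 normr0.
split=> [|a phi psi /asboolP hphi /asboolP hpsi]; apply/asboolP => i //.
exact: lin.
Qed.

HB.instance Definition _ (R : realType) (d : nat) :=
  GRing.isSubmodClosed.Build R ('I_d -> R -> R) (@schwartz_pred R d)
    (@schwartz_submod_closed R d).

Record schwartz (R : realType) (d : nat) := Schwartz {
  schwartz_val :> 'I_d -> R -> R;
  schwartz_valP : schwartz_val \in @schwartz_pred R d }.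

HB.instance Definition _ (R : realType) (d : nat) :=
  [isSub for @schwartz_val R d].
HB.instance Definition _ (R : realType) (d : nat) :=
  [Choice of schwartz R d by <:].
HB.instance Definition _ (R : realType) (d : nat) :=
  [SubChoice_isSubLmodule of schwartz R d by <:].

(* An increasing family of seminorms inducing the Schwartz topology. *)
Definition schwartz_seminorm (R : realType) (d : nat) (N : nat)
    (phi : schwartz R d) : R :=
  \sum_i \sum_(k < N.+1) \sum_(n < N.+1)
    sup [set `|u ^+ k * derive1n n (phi i) u| | u in [set: R]].

Definition tempered_pred (R : realType) (d : nat) :
    pred {linear schwartz R d -> R^o} :=
  fun w => `[< exists N C, forall phi, `|w phi| <= C * schwartz_seminorm N phi >].


Lemma tempered_pred0 (R : realType) (d : nat) : @tempered_pred R d \0.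
Proof. by apply/asboolP; exists 0, 0 => phi; rewrite mul0r normr0. Qed.

Record tempered (R : realType) (d : nat) := Tempered {
  tempered_val :> {linear schwartz R d -> R^o};
  tempered_valP : tempered_pred tempered_val }.

HB.instance Definition _ (R : realType) (d : nat) :=
  [isSub for @tempered_val R d].
HB.instance Definition _ (R : realType) (d : nat) :=
  [Choice of tempered R d by <:].
HB.instance Definition _ (R : realType) (d : nat) :=
  isPointed.Build (tempered R d) (Tempered (@tempered_pred0 R d)).

Definition cylinders (R : realType) (d : nat) : set (set (tempered R d)) :=
  [set A | exists (phi : schwartz R d) (B : set R),
    measurable B /\ A = [set w : tempered R d | B (w phi)]].

Definition white_noise_space (R : realType) (d : nat) :=
  g_sigma_algebraType (@cylinders R d).

Definition sqnorm (R : realType) (d : nat) (phi : schwartz R d) : R :=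
  \sum_i \int[lebesgue_measure]_u (phi i u ^+ 2).

(* Real and imaginary parts of E[exp(i <w, phi>)] = exp(- |phi|^2 / 2). *)
Definition is_white_noise_measure (R : realType) (d : nat)
    (mu : probability (white_noise_space R d) R) : Prop :=
  forall phi : schwartz R d,
    \int[mu]_w cos (w phi) = expR (- (sqnorm phi / 2)) /\
    \int[mu]_w sin (w phi) = 0.

Definition csqr (R : realType) (z : R[i]) : R :=
  complex.Re z ^+ 2 + complex.Im z ^+ 2.

Definition cmeasurable (dsp : measure_display) (X : measurableType dsp)
    (R : realType) (F : X -> R[i]) : Prop :=
  measurable_fun [set: X] (fun x => complex.Re (F x)) /\
  measurable_fun [set: X] (fun x => complex.Im (F x)).

Definition L2_sqnorm (R : realType) (d : nat)
    (mu : probability (white_noise_space R d) R)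
    (F : tempered R d -> R[i]) : \bar R :=
  (\int[mu]_w (csqr (F w))%:E)%E.

Definition in_L2 (R : realType) (d : nat)
    (mu : probability (white_noise_space R d) R)
    (F : tempered R d -> R[i]) : Prop :=
  cmeasurable (F : white_noise_space R d -> R[i]) /\ (L2_sqnorm mu F < +oo)%E.

(* The Lebesgue integral over R^n, as an iterated integral; it is only applied
   to nonnegative measurable functions, where this is Tonelli's theorem. *)
Fixpoint iter_integral (R : realType) (n : nat) :
    (n.-tuple R -> \bar R) -> \bar R :=
  if n is n'.+1 then fun f =>
    (\int[lebesgue_measure]_x iter_integral (fun u => f [tuple of x :: u]))%E
  else fun f => f [tuple].

(* A function in the n-th tensor power of L^2_{d,C}: [F j u] is the component
   of F (u_1, .., u_n) on e_{j_1} (x) .. (x) e_{j_n}. *)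
Definition kernel (R : realType) (d n : nat) : Type :=
  n.-tuple 'I_d -> n.-tuple R -> R[i].

Definition kernel_sqnorm (R : realType) (d n : nat) (F : kernel R d n) :
    \bar R :=
  (\sum_(j : n.-tuple 'I_d) iter_integral (fun u => (csqr (F j u))%:E))%E.

Definition permute (X : Type) (n : nat) (s : 'S_n) (t : n.-tuple X) :
    n.-tuple X :=
  [tuple tnth t (s k) | k < n].

Definition in_symL2 (R : realType) (d n : nat) (F : kernel R d n) : Prop :=
  [/\ forall j, cmeasurable (F j),
      (kernel_sqnorm F < +oo)%E
    & forall s j u, F (permute s j) (permute s u) = F j u].

(* <:w^{(x)n}:, phi^{(x)n}> = |phi|^n He_n(<w, phi> / |phi|), with He_n the
   n-th (probabilists') Hermite polynomial, written so that phi = 0 is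
   allowed. *)
Definition wick_power (R : realType) (d n : nat) (w : tempered R d)
    (phi : schwartz R d) : R :=
  \sum_(k < n./2.+1)
    (n`!%:R / (k`!%:R * (n - k.*2)`!%:R)) *
    (- (sqnorm phi / 2)) ^+ k * w phi ^+ (n - k.*2).

(* The operator A = - d^2/du^2 + u^2 + 1, componentwise. *)
Definition opA (R : realType) (d : nat) (f : 'I_d -> R -> R) : 'I_d -> R -> R :=
  fun i u => - derive1n 2 (f i) u + u ^+ 2 * f i u + f i u.

(* A list of pairs (c, phi) stands for the finite sum of the c phi^{(x)n};
   these sums are dense in the symmetric tensor power.  The kernel below is
   the image of that sum under (A^{(x)n})^p. *)
Definition finite_kernel (R : realType) (d : nat) (p n : nat)
    (l : seq (R[i] * schwartz R d)) : kernel R d n :=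
  fun j u => \sum_(cphi <- l)
    cphi.1 * (\prod_(k < n) iter p (@opA R d) cphi.2 (tnth j k) (tnth u k))%:C.

Definition finite_wick (R : realType) (d : nat) (n : nat)
    (l : seq (R[i] * schwartz R d)) (w : tempered R d) : R[i] :=
  \sum_(cphi <- l) cphi.1 * (wick_power n w cphi.2)%:C.

(* X = <:w^{(x)n}:, F>, extended from finite sums to all symmetric L^2 kernels
   F by L^2-continuity. *)
Definition is_wick_pairing (R : realType) (d : nat)
    (mu : probability (white_noise_space R d) R) (n : nat)
    (F : kernel R d n) (X : tempered R d -> R[i]) : Prop :=
  in_L2 mu X /\
  exists l : nat -> seq (R[i] * schwartz R d),
    (fun m => kernel_sqnorm (fun j u => finite_kernel 0 (l m) j u - F j u))
      @ \oo --> 0%E /\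
    (fun m => L2_sqnorm mu (fun w => finite_wick n (l m) w - X w))
      @ \oo --> 0%E.

(* F = sum_n <:w^{(x)n}:, F_n> with convergence in L^2(mu). *)
Definition chaos_decomposition (R : realType) (d : nat)
    (mu : probability (white_noise_space R d) R)
    (F : tempered R d -> R[i]) (Fn : forall n, kernel R d n) : Prop :=
  (forall n, in_symL2 (Fn n)) /\
  exists X : nat -> tempered R d -> R[i],
    (forall n, is_wick_pairing mu (Fn n) (X n)) /\
    (fun N => L2_sqnorm mu (fun w => F w - \sum_(n < N) X n w)) @ \oo --> 0%E.

(* G = (A^{(x)n})^p F: the operator (A^{(x)n})^p is the closure of its
   restriction to the finite sums above, on which it is essentially
   self-adjoint. *)
Definition is_opA_image (R : realType) (d p n : nat) (F G : kernel R d n) :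
    Prop :=
  in_symL2 G /\
  exists l : nat -> seq (R[i] * schwartz R d),
    (fun m => kernel_sqnorm (fun j u => finite_kernel 0 (l m) j u - F j u))
      @ \oo --> 0%E /\
    (fun m => kernel_sqnorm (fun j u => finite_kernel p (l m) j u - G j u))
      @ \oo --> 0%E.

(* ||F||_p^2 = sum_n n! |(A^{(x)n})^p F_n|^2.  The set below is empty, with
   infimum +oo, when some F_n is not in the domain of (A^{(x)n})^p; otherwise
   it is a singleton, since F determines the F_n up to null sets. *)
Definition hida_sqnorm (R : realType) (d : nat)
    (mu : probability (white_noise_space R d) R) (p : nat)
    (F : tempered R d -> R[i]) : \bar R :=
  ereal_inf [set x | exists Fn Gn : forall n, kernel R d n,
    [/\ chaos_decomposition mu F Fn,
        forall n, is_opA_image p (Fn n) (Gn n)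
      & x = (\sum_(0 <= n <oo) (n`!%:R%:E * kernel_sqnorm (Gn n)))%E]].

(* Membership in (S_d), for a representative F of its mu-class. *)
Definition hida_test (R : realType) (d : nat)
    (mu : probability (white_noise_space R d) R)
    (F : tempered R d -> R[i]) : Prop :=
  in_L2 mu F /\ forall p, (hida_sqnorm mu p F < +oo)%E.

(* An element of (S_d)', as a continuous linear functional on (S_d); its values
   outside [hida_test] are irrelevant.  The bound by some ||.||_p says that it
   lies in (S_d)_{-p}, and it forces equal values on mu-a.e. equal functions. *)
Record hida_distribution (R : realType) (d : nat)
    (mu : probability (white_noise_space R d) R) := HidaDistribution {
  hida_val :> (tempered R d -> R[i]) -> R[i];
  hida_linear : forall (a : R[i]) (F G : tempered R d -> R[i]),
    hida_test mu F -> hida_test mu G ->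
    hida_val (fun w => a * F w + G w) = a * hida_val F + hida_val G;
  hida_continuous : exists (p : nat) (C : R), forall F, hida_test mu F ->
    `|hida_val F| <= (C * Num.sqrt (fine (hida_sqnorm mu p F)))%:C }.

Definition hida_eq (R : realType) (d : nat)
    (mu : probability (white_noise_space R d) R)
    (Phi Psi : hida_distribution mu) : Prop :=
  forall F, hida_test mu F -> Phi F = Psi F.

(* Normalized exponential; it belongs to [hida_test mu]. *)
Definition wick_exp (R : realType) (d : nat) (phi : schwartz R d)
    (w : tempered R d) : R[i] :=
  (expR (w phi - sqnorm phi / 2))%:C.

Definition S_transform (R : realType) (d : nat)
    (mu : probability (white_noise_space R d) R)
    (Phi : hida_distribution mu) (phi : schwartz R d) : R[i] :=
  Phi (wick_exp phi).

(* The S-transform is injective, so a condition on S_transform Phi phi for all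
   phi determines Phi up to [hida_eq]; this is how Wick products, white noise
   and Donsker's delta function are specified below. *)
Definition is_wick_product (R : realType) (d : nat)
    (mu : probability (white_noise_space R d) R)
    (Phi Psi Xi : hida_distribution mu) : Prop :=
  forall phi, S_transform Xi phi = S_transform Phi phi * S_transform Psi phi.

Definition is_white_noise (R : realType) (d : nat)
    (mu : probability (white_noise_space R d) R) (i : 'I_d) (t : R)
    (Phi : hida_distribution mu) : Prop :=
  forall phi, S_transform Phi phi = (phi i t)%:C.

(* |<eta_t, phi>|^2 with eta_t the indicator of [0, t). *)
Definition eta_sqnorm (R : realType) (d : nat) (t : R) (phi : schwartz R d) :
    R :=
  \sum_i (\int[lebesgue_measure]_(u in `[0, t[) phi i u) ^+ 2.

Definition is_donsker_delta (R : realType) (d : nat)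
    (mu : probability (white_noise_space R d) R) (t : R)
    (Phi : hida_distribution mu) : Prop :=
  forall phi, S_transform Phi phi =
    ((2 * pi * t) `^ (- (d%:R / 2)) * expR (- (eta_sqnorm t phi / (2 * t))))%:C.

Definition hilbert_norm (R : realType) (H : lmodType R[i])
    (ip : {dot H for @Num.conj R[i]}) (h : H) : R :=
  Num.sqrt (complex.Re (ip h h)).

Definition hilbert_complete (R : realType) (H : lmodType R[i])
    (ip : {dot H for @Num.conj R[i]}) : Prop :=
  forall x : nat -> H,
    (forall e : R, 0 < e -> exists N : nat, forall m n : nat,
      (N <= m)%N -> (N <= n)%N -> hilbert_norm ip (x m - x n) < e) ->
    exists l : H, (fun n => hilbert_norm ip (x n - l)) @ \oo --> (0 : R).

Definition hida_bounded (R : realType) (d : nat)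
    (mu : probability (white_noise_space R d) R)
    (B : set (tempered R d -> R[i])) : Prop :=
  B `<=` hida_test mu /\
  forall p, exists M : R, forall F, B F -> (hida_sqnorm mu p F <= M%:E)%E.

(* The Hilbert space (H, ip) is embedded by j in (S_d)'; continuity is that of
   the strong dual topology, given by the seminorms Phi |-> sup_B |Phi| for
   bounded sets B of test functions. *)
Definition hilbert_subspace (R : realType) (d : nat)
    (mu : probability (white_noise_space R d) R)
    (H : lmodType R[i]) (ip : {dot H for @Num.conj R[i]})
    (j : H -> hida_distribution mu) : Prop :=
  [/\ hilbert_complete ip,
      forall (a : R[i]) (h k : H) F, hida_test mu F ->
        j (a *: h + k) F = a * j h F + j k F,
      forall h k : H, hida_eq (j h) (j k) -> h = k
    & forall B, hida_bounded mu B -> exists C : R, forall h F, B F ->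
        `|j h F| <= (C * hilbert_norm ip h)%:C].

Definition simple_function (R : realType) (H : lmodType R[i]) (s : R -> H) :
    Prop :=
  exists (n : nat) (A : 'I_n -> set R) (h : 'I_n -> H),
    (forall k, measurable (A k)) /\
    forall t, s t = \sum_(k < n) (\1_(A k) t : R)%:C *: h k.

(* Bochner integrability over ]0, T]; as T < +oo, simple functions are
   integrable. *)
Definition bochner_integrable (R : realType) (H : lmodType R[i])
    (ip : {dot H for @Num.conj R[i]}) (T : R) (g : R -> H) : Prop :=
  exists s : nat -> R -> H,
    [/\ forall m, simple_function (s m),
        {ae lebesgue_measure, forall t : R, 0 < t <= T ->
          (fun m => hilbert_norm ip (s m t - g t)) @ \oo --> (0 : R)}
      & (fun m => \int[lebesgue_measure]_(t in `]0%R, T])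
           (hilbert_norm ip (s m t - g t))%:E)%E @ \oo --> 0%E].

(* The integral of X over (0, T] exists as a Bochner integral in some Hilbert
   subspace of (S_d)'. *)
Definition bochner_integral_exists (R : realType) (d : nat)
    (mu : probability (white_noise_space R d) R) (T : R)
    (X : R -> hida_distribution mu) : Prop :=
  exists (H : lmodType R[i]) (ip : {dot H for @Num.conj R[i]})
      (j : H -> hida_distribution mu),
    hilbert_subspace ip j /\
    exists g : R -> H, bochner_integrable ip T g /\
      {ae lebesgue_measure, forall t : R, 0 < t <= T -> hida_eq (j (g t)) (X t)}.

(* Main.v *)
Require Import Defs.
From mathcomp Require Import all_boot all_order all_algebra.
From mathcomp Require Import complex.
From mathcomp Require Import all_classical all_reals all_analysis.
From mathcomp Require Import perm measurable_realfun ring lra zify.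

Import Order.TTheory GRing.Theory Num.Theory.
Import numFieldNormedType.Exports.
(* [finite_kernel] and [kernel] also name notions about Markov kernels; here
   they are the kernels of the chaos decomposition. *)
Import Defs.
Local Open Scope classical_set_scope.
Local Open Scope ring_scope.

Set Implicit Arguments.
Unset Strict Implicit.
Unset Printing Implicit Defensive.

(** Testing the integrand against one single Hida test function already rules
    out Bochner integrability near t = 0.  Take for phi the vector all of whose
    components are exp(-u^2/2), and for the test function its normalized
    exponential F.  The S-transform of the integrand at phi is
      (2 pi t)^(-d/2) exp(-|<eta_t, phi>|^2 / (2t)) phi_i(t).
    Since |<eta_t, phi>|^2 <= d t^2 and phi_i(0) = 1, for small t and d >= 2 this
    is at least c / t with c > 0 ([gauss_current_lower_bound]).

    In a Hilbert subspace H of (S_d)', evaluation at F is a continuous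
    functional L, because the singleton of F is a bounded set of test functions.
    If g were Bochner integrable in H, some simple function s would satisfy
    int |s - g| < oo; but L s is bounded while |L g| >= c / t almost everywhere,
    so |s - g| >= c' / t near 0, whose integral is infinite
    ([not_bochner_integrable_of_inverse]).

    The remaining work is to show that F is a test function at all
    ([hida_test_wick_exp_gauss]).  The Gaussian phi is chosen because
    A phi = 2 phi, so the kernels of F, phi^(n) / n!, are multiplied by 2^(pn)
    under the p-th power of A^(n) and all the norms |F|_p are explicit
    exponential series.  That these kernels give the chaos decomposition of F
    means that the Hermite generating series, evaluated at X = <w, phi>,
    converges in L^2(mu).  It converges pointwise ([hermite_sum_cvg]) and its
    partial sums are dominated by a multiple of exp |X| ([hermite_sum_bound]), so
    it suffices that X has exponential moments ([exp_moment]).  Only the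
    characteristic function of X is given.  Its central differences of order 2k
    at 0 are moments of sin(hX)^(2k), hence bounded by derivatives of a Gaussian
    near 0, and Fatou's lemma as h -> 0 bounds the even moments of X. *)

(** * The Gaussian function and its derivatives *)

Section Gauss.
Variable R : realType.
Implicit Types (u s x h : R) (n m k : nat).

Definition gauss u : R := expR (- (u ^+ 2 / 2)).

(** The n-th derivative of [gauss], that is (-1)^n He_n(u) exp(-u^2/2), through
    the three-term recurrence of the Hermite polynomials, which serves both the
    decay at infinity and the bounds near 0. *)
Fixpoint gauss_deriv n u : R :=
  match n with
  | 0 => gauss u
  | n1.+1 => - (u * gauss_deriv n1 u) -
      (if n1 is n2.+1 then n1%:R * gauss_deriv n2 u else 0)
  end.

Lemma gauss_derivSS n u : gauss_deriv n.+2 u =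
  - (u * gauss_deriv n.+1 u) - n.+1%:R * gauss_deriv n u.
Proof. by []. Qed.

Lemma is_derive_gauss u : is_derive u 1 gauss (gauss_deriv 1 u).
Proof.
rewrite /= subr0 /gauss -[fun=> _]/(expR \o (fun v => - (v ^+ 2 / 2))).
apply: is_derive_eq.
rewrite /GRing.scale /= !(mulr0,mul0r,addr0,add0r,mulr1,expr1).
by field.
Qed.

Lemma is_derive_gauss_deriv n u :
  is_derive u 1 (gauss_deriv n) (gauss_deriv n.+1 u).
Proof.
suff : is_derive u 1 (gauss_deriv n) (gauss_deriv n.+1 u) /\
       is_derive u 1 (gauss_deriv n.+1) (gauss_deriv n.+2 u) by case.
elim: n => [|n [IH1 IH2]].
  split; first exact: is_derive_gauss.
  have E : gauss_deriv 1 = (fun v => - (v * gauss v)).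
    by apply/funext => v /=; rewrite subr0.
  have dg := is_derive_gauss u.
  rewrite E; apply: is_derive_eq.
  rewrite gauss_derivSS /= /GRing.scale /= subr0; ring.
split=> //.
have E : gauss_deriv n.+2 = (fun v => - (v * gauss_deriv n.+1 v) -
    n.+1%:R * gauss_deriv n v) by [].
rewrite E; apply: is_derive_eq.
rewrite [in RHS]gauss_derivSS /GRing.scale /=.
rewrite -/(gauss_deriv n.+1 u) -/(gauss_deriv n.+2 u).
rewrite -[n.+2%:R]natr1; ring.
Qed.

Lemma gauss_ge0 u : 0 <= gauss u. Proof. exact: expR_ge0. Qed.

Lemma gauss_le1 u : gauss u <= 1.
Proof. by rewrite -expR0 ler_expR lerNl oppr0 divr_ge0 ?sqr_ge0. Qed.

Lemma derive1n_gauss n : derive1n n gauss = gauss_deriv n.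
Proof.
elim: n => // n IH; rewrite derive1nS IH; apply/funext => u.
by rewrite derive1E; have [_ ->] := is_derive_gauss_deriv n u.
Qed.

(** For y = u^2/2 >= 0 the exponential series gives y^k / k! <= exp y, which
    bounds even powers; odd ones follow from |u|^k <= 1 + u^(2k). *)
Lemma gauss_pow_bounded k : exists M, forall u, `|u ^+ k * gauss u| <= M.
Proof.
exists (1 + 2 ^+ k * k`!%:R) => u.
have [k0|k0] := posnP k.
  by rewrite k0 expr0 mul1r ger0_norm ?gauss_ge0 // (le_trans (gauss_le1 _)) //
    expr0 mul1r lerDl.
have u2 : 0 <= u ^+ 2 / 2 by rewrite divr_ge0 ?sqr_ge0.
have b : (u ^+ 2) ^+ k * gauss u <= 2 ^+ k * k`!%:R.
  rewrite /gauss expRN ler_pdivrMr ?expR_gt0 //.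
  have := expR_ge1Dxn k.-1 u2; rewrite prednK // expr_div_n => h.
  rewrite -ler_pdivrMl ?mulr_gt0 ?exprn_gt0 ?ltr0n ?fact_gt0 //.
  apply: le_trans h; rewrite invfM.
  by rewrite mulrC mulrA ler_wpDl.
rewrite normrM (ger0_norm (gauss_ge0 u)) normrX.
have le_pow : `|u| ^+ k <= 1 + (u ^+ 2) ^+ k.
  rewrite -[u ^+ 2]real_normK ?num_real // exprAC.
  have := exprn_ge0 k (normr_ge0 u); move: (`|u| ^+ k) => y y0.
  have : 0 <= (y - 1/2) ^+ 2 by exact: sqr_ge0.
  nra.
apply: (@le_trans _ _ ((1 + (u ^+ 2) ^+ k) * gauss u)).
  by rewrite ler_wpM2r ?gauss_ge0.
by rewrite mulrDl mul1r lerD ?gauss_le1.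
Qed.

Lemma gauss_schwartz : schwartz_fun gauss.
Proof.
split=> [n u|k n]; rewrite derive1n_gauss.
  by have [] := is_derive_gauss_deriv n u.
suff : forall k, (exists M, forall u, `|u ^+ k * gauss_deriv n u| <= M) /\
   (exists M, forall u, `|u ^+ k * gauss_deriv n.+1 u| <= M) by case/(_ k).
elim: n => [|n IH] {}k.
  split; first exact: gauss_pow_bounded.
  have [M HM] := gauss_pow_bounded k.+1; exists M => u.
  by rewrite /= subr0 mulrN normrN mulrA -exprSr.
have [_ HM] := IH k; split=> //.
have [_ [M1 HM1]] := IH k.+1; have [[M2 HM2] _] := IH k.
exists (M1 + n.+1%:R * M2) => u.
rewrite gauss_derivSS mulrBr mulrN mulrA -exprSr mulrCA.
rewrite (le_trans (ler_normB _ _)) // normrN lerD //.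
by rewrite normrM normr_nat ler_wpM2l.
Qed.

(** Growth like k! for the derivative of order 2k is what makes the series of
    the even moments, divided by (2k)!, converge everywhere.  The
    recurrence propagates it together with the companion bound 3^k (k+1)! for
    the odd orders. *)
Lemma gauss_deriv_bound k u : `|u| <= 1 ->
  `|gauss_deriv k.*2 u| <= 3 ^+ k * k`!%:R.
Proof.
move=> u1.
suff : `|gauss_deriv k.*2 u| <= 3 ^+ k * k`!%:R /\
       `|gauss_deriv k.*2.+1 u| <= 3 ^+ k * k.+1`!%:R by case.
have step n A B : `|gauss_deriv n u| <= A -> `|gauss_deriv n.+1 u| <= B ->
    `|gauss_deriv n.+2 u| <= B + n.+1%:R * A.
  move=> hA hB; rewrite gauss_derivSS (le_trans (ler_normB _ _)) //.
  rewrite lerD //.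
    rewrite normrN normrM (le_trans _ hB) // ler_piMl //.
  by rewrite normrM normr_nat ler_wpM2l.
elim: k => [|k [IH1 IH2]].
  split; rewrite /= ?subr0 ?expr0 ?fact0 ?factS ?mul1r ?muln1.
    by rewrite ger0_norm ?gauss_ge0 // gauss_le1.
  rewrite normrN normrM mulr_ile1 //.
  by rewrite ger0_norm ?gauss_ge0 // gauss_le1.
have kf : 0 < (3 ^+ k * k`!%:R : R).
  by rewrite mulr_gt0 ?exprn_gt0 // ltr0n fact_gt0.
have S1 := step _ _ _ IH1 IH2.
have k0 : 0 <= k%:R :> R by rewrite ler0n.
have H1 : `|gauss_deriv k.*2.+2 u| <= 3 ^+ k.+1 * k.+1`!%:R.
  apply: (le_trans S1).
  rewrite exprSr factS natrM -[in k.*2.+1%:R]natr1 -mul2n natrM -[k.+1%:R]natr1.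
  move: kf k0; move: (3 ^+ k) (k`!%:R : R) (k%:R : R) => a b c; nra.
rewrite doubleS; split=> //.
apply: (le_trans (step _ _ _ IH2 H1)).
rewrite exprSr !factS !natrM -[k.*2.+2%:R]natr1 -[k.*2.+1%:R]natr1 -mul2n natrM.
rewrite -[k.+2%:R]natr1 -[k.+1%:R]natr1.
move: kf k0; move: (3 ^+ k) (k`!%:R : R) (k%:R : R) => a b c ab c0.
have -> : a * 3 * ((c + 1 + 1) * ((c + 1) * b)) =
  a * b * (3 * (c + 1 + 1) * (c + 1)) by ring.
have -> : a * 3 * ((c + 1) * b) + (2 * c + 1 + 1) * (a * ((c + 1) * b)) =
  a * b * ((2 * c + 5) * (c + 1)) by ring.
by rewrite ler_pM2l //; nra.
Qed.

(** Central difference with step 2h: two applications give a second difference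
    centred at the same point. *)
Definition cdiff h (f : R -> R) u := f (u + h) - f (u - h).

(** Each difference costs one derivative and a factor 2h, by the mean value
    theorem; the m-th difference at u only sees points within m h of u. *)
Lemma cdiff_bound h m (f : nat -> R -> R) (M u : R) : 0 <= h ->
  (forall i (v : R), is_derive v 1 (f i) (f i.+1 v)) ->
  (forall v, `|v - u| <= m%:R * h -> `|f m v| <= M) ->
  `|iter m (cdiff h) (f 0) u| <= (2 * h) ^+ m * M.
Proof.
move=> h0; elim: m f M => [|m IH] f M df fM.
  by rewrite expr0 mul1r /= fM // subrr normr0 mul0r.
rewrite iterSr exprSr -mulrA.
apply: (IH (fun i => cdiff h (f i))) => [i v|v vu].
  rewrite /cdiff.
  have da : is_derive (v + h) 1 (f i) (f i.+1 (v + h)) by [].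
  have db : is_derive (v - h) 1 (f i) (f i.+1 (v - h)) by [].
  have -> : (fun u0 => f i (u0 + h) - f i (u0 - h)) =
      (f i \o (fun w => w + h)) - (f i \o (fun w => w - h)) by [].
  by apply: is_derive_eq; rewrite /GRing.scale /= !addr0 subr0 !mulr1.
have le_h : v - h <= v + h by rewrite lerBlDr -addrA lerDl addr_ge0.
have cont : {within `[v - h, v + h], continuous f m}.
  apply: continuous_subspaceT => x.
  by apply/differentiable_continuous/derivable1_diffP; have [] := df m x.
rewrite /cdiff; have [c cI ->] := MVT_segment le_h (fun x _ => df m x) cont.
rewrite (_ : v + h - (v - h) = 2 * h); last ring.
rewrite normrM mulrC (ger0_norm (_ : 0 <= 2 * h)) ?mulr_ge0 //.
rewrite ler_wpM2l ?mulr_ge0 // fM //.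
move: cI; rewrite in_itv /= => /andP[c1 c2].
have cv : `|c - v| <= h by rewrite ler_norml; apply/andP; split; lra.
rewrite (_ : c - u = (v - u) + (c - v)); last ring.
by rewrite (le_trans (ler_normD _ _)) // -natr1 mulrDl mul1r lerD.
Qed.

End Gauss.

(** * Exponential moments from a Gaussian characteristic function *)

Lemma exp_sum_le (R : realType) (y : R) N : 0 <= y ->
  \sum_(k < N) y ^+ k / k`!%:R <= expR y.
Proof.
move=> y0; have := nondecreasing_cvgn_le _ (is_cvg_series_exp_coeff y) N.
rewrite /series /= big_mkord; apply => m n mn.
rewrite -subr_ge0 -[X in X - _]/(series (exp_coeff y) n) -[X in _ - X]/(series (exp_coeff y) m).
by rewrite sub_series_geq // sumr_ge0 // => i _; exact: exp_coeff_ge0.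
Qed.

Section Moments.
Context (dsp : measure_display) (T : measurableType dsp) (R : realType).
Context (P : probability T R).

Lemma fatou_bound (f : nat -> T -> R) (g : T -> R) (B : \bar R) :
  (forall n, measurable_fun setT (f n)) -> (forall n x, 0 <= f n x) ->
  (forall x, f n x @[n --> \oo] --> g x) ->
  (forall n, \int[P]_x (f n x)%:E <= B)%E -> (\int[P]_x (g x)%:E <= B)%E.
Proof.
move=> mf f0 fg fB.
have E x : limn_einf (fun n => (f n x)%:E) = (g x)%:E.
  apply: (cvg_limn_einf_sup _).1; apply: cvg_comp (fg x) _.
  by apply: cvg_EFin; [exact: nearW|exact: cvg_id].
under eq_integral do rewrite -E.
have mEf n : measurable_fun setT (fun x => (f n x)%:E) by apply/measurable_EFinP.
apply: (le_trans (fatou P measurableT mEf _)); first by move=> n x _ /=; rewrite lee_fin.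
rewrite limn_einf_lim; apply: lime_le; first exact: is_cvg_einfs.
apply: nearW => n; apply: le_trans (fB n).
by apply: ereal_inf_lbound; exists n => /=.
Qed.

Lemma integrable_bounded (f : T -> R) (M : R) : measurable_fun setT f ->
  (forall x, `|f x| <= M) -> P.-integrable setT (EFin \o f).
Proof.
move=> mf fM; apply: measurable_bounded_integrable => //.
  by rewrite (le_lt_trans (probability_le1 _ _)) ?ltry.
by exists M; split; rewrite ?num_real // => N MN x _; exact: le_trans (fM x) (ltW MN).
Qed.

Variables (X : T -> R) (mX : measurable_fun setT X) (sigma : R).
Hypothesis charX : forall s, \int[P]_w cos (s * X w) = gauss (sigma * s).

Let mcos s : measurable_fun setT (fun w => cos (s * X w)).
Proof.
apply: (measurableT_comp (f := cos)); first exact: (continuous_measurable_fun (@continuous_cos R)).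
exact: measurable_funM.
Qed.

Let msin s : measurable_fun setT (fun w => sin (s * X w)).
Proof.
apply: (measurableT_comp (f := sin)); first exact: (continuous_measurable_fun (@continuous_sin R)).
exact: measurable_funM.
Qed.

(** The second difference of u |-> cos(u X) multiplies it by -(2 sin(h X))^2,
    because cos(a + 2b) - 2 cos a + cos(a - 2b) = - 4 sin^2 b cos a. *)
Lemma cdiff_char h k u :
  iter k.*2 (cdiff h) (fun s => gauss (sigma * s)) u =
  \int[P]_w (cos (u * X w) * (- (2 * sin (h * X w)) ^+ 2) ^+ k).
Proof.
elim: k u => [|k IH] u.
  by rewrite /= -charX; apply: eq_Rintegral => w _; rewrite expr0 mulr1.
pose F v w := cos (v * X w) * (- (2 * sin (h * X w)) ^+ 2) ^+ k.
have mF v : measurable_fun setT (F v).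
  apply: measurable_funM; first exact: mcos.
  apply: measurable_funX; apply: measurableT_comp => //.
  by apply: measurable_funX; exact: measurable_funM.
have cos1 x : `|cos x| <= 1 :> R by rewrite ler_norml cos_geN1 cos_le1.
have sin1 x : `|sin x| <= 1 :> R by rewrite ler_norml sin_geN1 sin_le1.
have iF v : P.-integrable setT (EFin \o F v).
  apply: (@integrable_bounded _ (4 ^+ k)) => // w.
  rewrite normrM normrX normrN normrX normrM (ger0_norm (_ : 0 <= 2)) //.
  rewrite -[leRHS]mul1r ler_pM // lerXn2r ?nnegrE //.
  rewrite (_ : 4 = 2 ^+ 2 :> R); last by rewrite -natrX.
  by rewrite lerXn2r ?nnegrE // -[leRHS]mulr1 ler_pM.
have -> : \int[P]_w (cos (u * X w) * (- (2 * sin (h * X w)) ^+ 2) ^+ k.+1) =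
   \int[P]_w (F (u + 2 * h) w - F u w - (F u w - F (u - 2 * h) w)).
  apply: eq_Rintegral => w _; rewrite /F exprS.
  rewrite [(u + _) * _]mulrDl [(u - _) * _]mulrBl cosD cosB.
  set b := h * X w; rewrite (_ : 2 * h * X w = b *+ 2); last by rewrite -mulrA mulr_natl.
  rewrite cos_mulr2n.
  have := cos2sin2 b; move: (cos b) (sin b) (sin (b *+ 2)) => cb sb s2 ->.
  ring.
rewrite doubleS !iterS /cdiff !IH -/(F _).
rewrite !RintegralB //; last 2 first.
- exact: (integrableB measurableT (iF _) (iF _)).
- exact: (integrableB measurableT (iF _) (iF _)).
have -> : u + h + h = u + 2 * h by ring.
have -> : u - h - h = u - 2 * h by ring.
by rewrite addrK subrK.
Qed.

(** At u = 0 the differences of the characteristic function are moments of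
    sin(h X); the constraint on h keeps all the sampled points in [-1, 1], where
    the derivatives of the Gaussian are controlled. *)
Lemma sin_moment_bound (h : R) k : 0 <= h -> k.*2%:R * h * `|sigma| <= 1 ->
  (\int[P]_w ((sin (h * X w)) ^+ k.*2)%:E <=
     (h ^+ k.*2 * ((3 * sigma ^+ 2) ^+ k * k`!%:R))%:E)%E.
Proof.
move=> h0 hs.
pose G i s := sigma ^+ i * gauss_deriv i (sigma * s).
have dG i (v : R) : is_derive v 1 (G i) (G i.+1 v).
  have d1 := is_derive_gauss_deriv i (sigma * v).
  have -> : G i = sigma ^+ i *: (gauss_deriv i \o (fun s => sigma * s)) by [].
  apply: is_derive_eq.
  rewrite /G [sigma ^+ i.+1]exprS; move: (gauss_deriv i.+1 _) => y.
  by rewrite /GRing.scale /= mulr1; ring.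
have even (x : R) : x ^+ k.*2 = (x ^+ 2) ^+ k by rewrite -exprM mul2n.
have bG v : `|v - 0| <= k.*2%:R * h ->
    `|G k.*2 v| <= sigma ^+ k.*2 * (3 ^+ k * k`!%:R).
  rewrite subr0 => vh; rewrite normrM even normrX (ger0_norm (sqr_ge0 _)) //.
  rewrite ler_wpM2l ?(exprn_ge0 _ (sqr_ge0 _)) //; apply: gauss_deriv_bound.
  by rewrite normrM mulrC (le_trans _ hs) // ler_wpM2r.
have := cdiff_bound h0 dG bG.
have -> : G 0 = (fun s => gauss (sigma * s)).
  by apply/funext => s; rewrite /G expr0 mul1r.
have iS : P.-integrable setT (fun w => ((sin (h * X w)) ^+ k.*2)%:E).
  apply: (@integrable_bounded (fun w => (sin (h * X w)) ^+ k.*2) 1); first exact: measurable_funX.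
  by move=> w; rewrite normrX exprn_ile1 // ler_norml sin_geN1 sin_le1.
rewrite cdiff_char.
have -> : \int[P]_w (cos (0 * X w) * (- (2 * sin (h * X w)) ^+ 2) ^+ k) =
   ((-1) ^+ k * 2 ^+ k.*2) * \int[P]_w (sin (h * X w)) ^+ k.*2.
  rewrite -RintegralZl //.
  apply: eq_Rintegral => w _; rewrite mul0r cos0 mul1r !even.
  by rewrite -mulrA -exprMn -exprMn mulN1r exprMn.
rewrite !normrM normrX normrN1 expr1n mul1r.
rewrite (ger0_norm (_ : 0 <= 2 ^+ k.*2)) ?exprn_ge0 //.
rewrite [(2 * h) ^+ _]exprMn -mulrA ler_pM2l ?exprn_gt0 //.
rewrite ger0_norm; last first.
  by apply: Rintegral_ge0 => w _; rewrite even (exprn_ge0 _ (sqr_ge0 _)).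
move=> H.
rewrite -[leLHS]fineK; last exact: integrable_fin_num.
rewrite lee_fin (le_trans H) // exprMn -even.
by rewrite (mulrCA (sigma ^+ _)) -!mulrA.
Qed.

(** Fatou's lemma as h -> 0, since sin(h x) / h -> x. *)
Lemma even_moment_bound k :
  (\int[P]_w ((X w) ^+ k.*2)%:E <= ((3 * sigma ^+ 2) ^+ k * k`!%:R)%:E)%E.
Proof.
pose c : R := k.*2%:R * `|sigma| + 1.
have c0 : 0 < c by rewrite ltr_wpDl ?mulr_ge0.
pose h n : R := (c * n.+1%:R)^-1.
have h0 n : 0 < h n by rewrite invr_gt0 mulr_gt0.
apply: (@fatou_bound (fun n w => (sin (h n * X w) / h n) ^+ k.*2)).
- move=> n; apply: measurable_funX; apply: measurable_funM => //; exact: msin.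
- by move=> n w; rewrite -mul2n exprM (exprn_ge0 _ (sqr_ge0 _)).
- move=> w.
  have D : is_derive (0 : R) 1 (sin \o (fun s => s * X w)) (X w).
    by apply: is_derive_eq; rewrite mul0r cos0 mul1r /GRing.scale /= !mulr0 add0r mulr1.
  have hc : h n @[n --> \oo] --> (0 : R).
    have -> : h = (fun n => c^-1 * harmonic n).
      by apply/funext => n; rewrite /h /harmonic invfM.
    by rewrite -[X in _ --> X](mulr0 c^-1); apply: cvgM; [exact: cvg_cst|exact: cvg_harmonic].
  have [q [qE qc q0]] := (is_derive1_caratheodory _ _ _).1 D.
  have E n : sin (h n * X w) / h n = q (h n).
    have := qE (h n); rewrite /= mul0r sin0 !subr0 => ->.
    by rewrite mulfK // gt_eqF.
  under eq_fun do rewrite E.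
  rewrite -q0; apply: (@cvg_comp _ _ _ (q \o h) (fun y : R => y ^+ k.*2));
    last exact: exprn_continuous.
  exact: (cvg_comp _ _ hc qc).
- move=> n.
  have mE : measurable_fun setT (fun w => ((sin (h n * X w)) ^+ k.*2)%:E).
    apply/measurable_EFinP; apply: measurable_funX; exact: msin.
  under eq_integral do rewrite expr_div_n mulrC EFinM.
  have even (x : R) : 0 <= x ^+ k.*2 by rewrite -mul2n exprM (exprn_ge0 _ (sqr_ge0 _)).
  rewrite ge0_integralZl_EFin //; last 2 first.
  + by move=> w _; rewrite lee_fin.
  + by rewrite invr_ge0.
  have hk : 0 < h n ^+ k.*2 by rewrite exprn_gt0.
  rewrite lee_pdivrMl //; apply: sin_moment_bound; first exact: ltW.
  rewrite /h mulrAC ler_pdivrMr ?mulr_gt0 // mul1r.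
  have : c <= c * n.+1%:R by rewrite ler_peMr ?(ltW c0) ?ler1n.
  by apply: le_trans; rewrite /c lerDl.
Qed.

(** As (k!)^2 <= (2k)!, the k-th term of the series of E cosh(a X) is at most
    (3 a^2 sigma^2)^k / k!. *)
Lemma exp_moment (a : R) : P.-integrable setT (fun w => (expR (a * `|X w|))%:E).
Proof.
have maX b : measurable_fun setT (fun w => b * X w) by exact: measurable_funM.
have mexp (f : T -> R) : measurable_fun setT f -> measurable_fun setT (fun w => expR (f w)).
  by move=> mf; apply: (measurableT_comp (f := expR)) => //; exact: measurable_expR.
pose B : R := 2 * expR (3 * a ^+ 2 * sigma ^+ 2).
have bound : (\int[P]_w (expR (a * X w) + expR (- (a * X w)))%:E <= B%:E)%E.
  pose f N w := \sum_(k < N) 2 * a ^+ k.*2 / k.*2`!%:R * X w ^+ k.*2 : R.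
  have even (x : R) k : 0 <= x ^+ k.*2 by rewrite -mul2n exprM (exprn_ge0 _ (sqr_ge0 _)).
  have c0 k : 0 <= 2 * a ^+ k.*2 / k.*2`!%:R by rewrite divr_ge0 ?mulr_ge0.
  have fE N w : f N w = series (exp_coeff (a * X w)) N.*2 + series (exp_coeff (- (a * X w))) N.*2.
    rewrite /f /series /= !big_mkord; elim: N => [|N IH]; first by rewrite !big_ord0 addr0.
    rewrite big_ord_recr /= IH doubleS !big_ord_recr /= /exp_coeff /=.
    rewrite (exprNn _ N.*2) (exprNn _ N.*2.+1) (exprS (-1)) -signr_odd odd_double expr0.
    rewrite exprMn; ring.
  have dbl : N.*2 @[N --> \oo] --> \oo.
    apply/cvgnyPge => M; exists M => // n /= Mn; by rewrite (leq_trans Mn) // -addnn leq_addr.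
  apply: (@fatou_bound f).
  - move=> N; apply: measurable_sum => k; apply: measurable_funM => //.
    exact: measurable_funX.
  - by move=> N w; apply: sumr_ge0 => k _; rewrite mulr_ge0.
  - move=> w; under eq_fun do rewrite fE.
    by apply: cvgD; apply: (cvg_comp _ _ dbl); exact: is_cvg_series_exp_coeff.
  - move=> N; under eq_integral do rewrite /f -sumEFin.
    rewrite ge0_integral_sum //; last 2 first.
    + move=> k; apply/measurable_EFinP; apply: measurable_funM => //.
      exact: measurable_funX.
    + by move=> k w _; rewrite lee_fin mulr_ge0.
    have sB : \sum_(k < N) 2 * ((3 * a ^+ 2 * sigma ^+ 2) ^+ k / k`!%:R) <= B.
      rewrite -mulr_sumr /B ler_pM2l //.
      apply: exp_sum_le; apply: mulr_ge0; last exact: sqr_ge0.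
      by apply: mulr_ge0 => //; exact: sqr_ge0.
    apply: (@le_trans _ _ (\sum_(k < N) 2 * ((3 * a ^+ 2 * sigma ^+ 2) ^+ k / k`!%:R))%:E);
      last by rewrite lee_fin.
    rewrite -sumEFin; apply: lee_sum => k _.
    under eq_integral do rewrite EFinM.
    rewrite ge0_integralZl_EFin //; last 2 first.
    + by move=> w _; rewrite lee_fin.
    + by apply/measurable_EFinP; exact: measurable_funX.
    apply: (@le_trans _ _ ((2 * a ^+ k.*2 / k.*2`!%:R)%:E * ((3 * sigma ^+ 2) ^+ k * k`!%:R)%:E)%E).
      by rewrite lee_wpmul2l ?lee_fin //; exact: even_moment_bound.
    rewrite -EFinM lee_fin.
    have fk j : 0 < (j`!%:R : R) by rewrite ltr0n fact_gt0.
    have bin : (k`!%:R : R) * k`!%:R <= k.*2`!%:R.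
      rewrite -natrM ler_nat.
      have := @bin_fact k.*2 k; rewrite -addnn leq_addr addnK => <- //.
      by rewrite leq_pmull // bin_gt0 leq_addr.
    have sq (x : R) : (x ^+ 2) ^+ k = x ^+ k.*2 by rewrite -exprM mul2n.
    rewrite (exprMn k (3 * a ^+ 2)) (exprMn k 3 (a ^+ 2)) (exprMn k 3 (sigma ^+ 2)).
    rewrite !sq.
    have -> : 2 * a ^+ k.*2 / k.*2`!%:R * (3 ^+ k * sigma ^+ k.*2 * k`!%:R) =
      2 * (3 ^+ k * a ^+ k.*2 * sigma ^+ k.*2 * (k`!%:R / k.*2`!%:R)).
      by field; rewrite gt_eqF.
    rewrite ler_pM2l // ler_wpM2l //.
      by apply: mulr_ge0 => //; apply: mulr_ge0 => //; exact: exprn_ge0.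
    by rewrite ler_pdivrMr // ler_pdivlMl.
apply/integrableP; split; first by apply/measurable_EFinP; apply: mexp;
  apply: measurable_funM => //; exact: measurableT_comp.
apply: (@le_lt_trans _ _ B%:E); last exact: ltry.
apply: le_trans bound; apply: ge0_le_integral => //.
- apply/measurable_EFinP; apply: measurableT_comp => //; apply: mexp.
  by apply: measurable_funM => //; exact: measurableT_comp.
- apply/measurable_EFinP; apply: measurable_funD; apply: mexp => //.
  exact: measurableT_comp.
- move=> w _; rewrite /= lee_fin (ger0_norm (expR_ge0 _)).
  have [x0|x0] := leP 0 (X w).
    by rewrite ger0_norm // lerDl expR_ge0.
  by rewrite ltr0_norm // mulrN lerDr expR_ge0.
Qed.
End Moments.

(** * The generating series of the Hermite polynomials *)

Section HermiteSeries.
Variable R : realType.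
Implicit Types (x y : R) (n k N : nat).

(** The coefficient of z^n in exp(y z^2 + x z).  For y = - s^2 / 2 it is
    s^n He_n(x / s) / n!, the Wick power divided by n!. *)
Definition hermite_term n y x : R :=
  \sum_(k < n./2.+1) y ^+ k / k`!%:R * (x ^+ (n - k.*2) / (n - k.*2)`!%:R).

Let esum N x : R := \sum_(k < N) x ^+ k / k`!%:R.

Let esum_cvg x : esum N x @[N --> \oo] --> expR x.
Proof.
have -> : (fun N => esum N x) = series (exp_coeff x).
  by apply/funext => N; rewrite /esum /series /= big_mkord.
exact: is_cvg_series_exp_coeff.
Qed.

Let term_ge0 k x : 0 <= `|x| ^+ k / k`!%:R.
Proof. by rewrite divr_ge0 ?exprn_ge0. Qed.

Let norm_term k x : `|x ^+ k / k`!%:R| = `|x| ^+ k / k`!%:R.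
Proof. by rewrite normrM normrX normrV ?unitfE ?pnatr_eq0 -?lt0n ?fact_gt0 // normr_nat. Qed.

Let esumS x m : esum m.+1 x = esum m x + x ^+ m / m`!%:R.
Proof. by rewrite /esum big_ord_recr. Qed.

Let esum_homo x m n : (m <= n)%N -> esum m `|x| <= esum n `|x|.
Proof.
elim: n => [|n IH]; first by rewrite leqn0 => /eqP ->.
rewrite leq_eqVlt => /predU1P[->//|/IH h]; rewrite esumS (le_trans h) //.
by rewrite lerDl.
Qed.

Let esum_diff x m n : (m <= n)%N ->
  `|esum n x - esum m x| <= esum n `|x| - esum m `|x|.
Proof.
elim: n => [|n IH]; first by rewrite leqn0 => /eqP ->; rewrite !subrr normr0.
rewrite leq_eqVlt => /predU1P[->|/IH h]; first by rewrite !subrr normr0.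
rewrite !esumS addrAC (le_trans (ler_normD _ _)) // [leRHS]addrAC lerD //.
by rewrite norm_term.
Qed.

Let esum_tail x m : `|expR x - esum m x| <= expR `|x| - esum m `|x|.
Proof.
have c1 : (`|esum n x - esum m x|) @[n --> \oo] --> `|expR x - esum m x|.
  by apply: cvg_norm; apply: cvgB; [exact: esum_cvg|exact: cvg_cst].
have c2 : (esum n `|x| - esum m `|x|) @[n --> \oo] --> expR `|x| - esum m `|x|.
  by apply: cvgB; [exact: esum_cvg|exact: cvg_cst].
apply: (ler_cvg_to c1 c2); exists m => // n /= mn; exact: esum_diff.
Qed.

(** Summing first over the power of x turns the partial sums into a
    truncated Cauchy product, in which every factor is a partial sum of an
    exponential series (the inner sum is empty once 2k >= N). *)
Lemma hermite_sumE y x N : \sum_(n < N) hermite_term n y x =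
  \sum_(k < N) y ^+ k / k`!%:R * \sum_(j < N - k.*2) x ^+ j / j`!%:R.
Proof.
elim: N => [|N IH]; first by rewrite !big_ord0.
rewrite big_ord_recr /= IH.
have -> : \sum_(k < N) y ^+ k / k`!%:R * (\sum_(j < N - k.*2) x ^+ j / j`!%:R) =
    \sum_(k < N.+1) y ^+ k / k`!%:R * (\sum_(j < N - k.*2) x ^+ j / j`!%:R).
  rewrite [RHS]big_ord_recr /= (_ : (N - N.*2 = 0)%N); last first.
    by apply/eqP; rewrite subn_eq0 -addnn leq_addr.
  by rewrite big_ord0 mulr0 addr0.
rewrite /hermite_term (big_ord_widen N.+1 (fun k => y ^+ k / k`!%:R *
  (x ^+ (N - k.*2) / (N - k.*2)`!%:R))) /=; last first.
  by rewrite ltnS leq_half_double -addnn (leq_trans (leq_addr N N)).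
rewrite [X in _ + X]big_mkcond /= -big_split /=; apply: eq_bigr => k _.
rewrite ltnS geq_half_double; have [h|h] := leqP k.*2 N.
  by rewrite subSn // big_ord_recr /= mulrDr.
rewrite addr0 (_ : (N.+1 - k.*2 = 0)%N); last by apply/eqP; rewrite subn_eq0.
by rewrite (_ : (N - k.*2 = 0)%N) //; apply/eqP; rewrite subn_eq0 ltnW.
Qed.

Lemma hermite_sum_bound y x N :
  `|\sum_(n < N) hermite_term n y x| <= expR `|y| * expR `|x|.
Proof.
rewrite hermite_sumE (le_trans (ler_norm_sum _ _ _)) //.
apply: (@le_trans _ _ (\sum_(k < N) `|y| ^+ k / k`!%:R * expR `|x|)).
  apply: ler_sum => k _; rewrite normrM norm_term ler_wpM2l //.
  rewrite (le_trans (ler_norm_sum _ _ _)) //.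
  by under eq_bigr do rewrite norm_term; exact: exp_sum_le.
by rewrite -mulr_suml ler_wpM2r ?expR_ge0 // exp_sum_le.
Qed.

(** Cut the outer sum at M = N / 4: for k < M the inner sum has at least M
    terms, so it is within a tail of exp x; for k >= M the outer terms form a
    tail of exp y. *)
Lemma hermite_sum_cvg y x :
  \sum_(n < N) hermite_term n y x @[N --> \oo] --> expR y * expR x.
Proof.
pose A := expR `|y|; pose E := expR `|x|.
have quarter : (N %/ 4)%N @[N --> \oo] --> \oo.
  apply/cvgnyPge => M; exists (4 * M)%N => // n /= Mn; by rewrite leq_divRL // mulnC.
pose err M := A * (E - esum M `|x|) + E * (A - esum M `|y|).
have err0 : err (N %/ 4)%N @[N --> \oo] --> (0 : R).
  have -> : 0 = A * (E - E) + E * (A - A) :> R by rewrite !subrr !mulr0 addr0.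
  apply: (@cvg_comp _ _ _ (fun N => (N %/ 4)%N) err _ _ _ quarter).
  by apply: cvgD; apply: cvgM; (try exact: cvg_cst); apply: cvgB;
    (try exact: cvg_cst); exact: esum_cvg.
have bound N : `|esum N y * expR x - \sum_(n < N) hermite_term n y x| <= err (N %/ 4)%N.
  set M := (N %/ 4)%N.
  have M4 : (4 * M <= N)%N by rewrite mulnC leq_divM.
  have MN : (M <= N)%N by exact: leq_div.
  rewrite hermite_sumE /esum mulr_suml -sumrB.
  have tail k : `|y ^+ k / k`!%:R * expR x -
        y ^+ k / k`!%:R * (\sum_(j < N - k.*2) x ^+ j / j`!%:R)| <=
      `|y| ^+ k / k`!%:R * (E - esum (N - k.*2) `|x|).
    by rewrite -mulrBr normrM norm_term ler_wpM2l //; exact: esum_tail.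
  rewrite (le_trans (ler_norm_sum _ _ _)) //.
  apply: le_trans (ler_sum _ (fun (k : 'I_N) _ => tail k)) _.
  have Epos m : 0 <= E - esum m `|x| by rewrite subr_ge0 exp_sum_le.
  rewrite -(big_mkord xpredT (fun k => `|y| ^+ k / k`!%:R * (E - esum (N - k.*2) `|x|))).
  rewrite (@big_cat_nat _ _ _ M) //= /err lerD //.
    rewrite big_mkord (@le_trans _ _ (\sum_(k < M) `|y| ^+ k / k`!%:R * (E - esum M `|x|))) //.
      apply: ler_sum => k _; rewrite ler_wpM2l // lerD2l lerN2 esum_homo //.
      have := ltn_ord k; lia.
    by rewrite -mulr_suml ler_wpM2r // exp_sum_le.
  apply: (@le_trans _ _ (\sum_(M <= k < N) `|y| ^+ k / k`!%:R * E)).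
    apply: ler_sum => k _; rewrite ler_wpM2l // gerBl.
    by apply: sumr_ge0.
  rewrite -mulr_suml mulrC ler_wpM2l ?expR_ge0 //.
  have -> : \sum_(M <= k < N) `|y| ^+ k / k`!%:R = esum N `|y| - esum M `|y|.
    rewrite /esum -!(big_mkord xpredT (fun k => `|y| ^+ k / k`!%:R)).
    by rewrite [in RHS](@big_cat_nat _ _ _ M 0 N) //= addrAC subrr add0r.
  by rewrite lerB // exp_sum_le.
have c1 : esum N y * expR x - \sum_(n < N) hermite_term n y x @[N --> \oo] --> (0 : R).
  apply: norm_cvg0; apply: (squeeze_cvgr _ (cvg_cst 0) err0).
  by apply: nearW => N; rewrite normr_ge0 bound.
have -> : (fun N => \sum_(n < N) hermite_term n y x) = (fun N => esum N y * expR x -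
    (esum N y * expR x - \sum_(n < N) hermite_term n y x)).
  by apply/funext => N; rewrite opprB addrC subrK.
rewrite -[X in _ --> X]subr0; apply: cvgB c1.
by apply: cvgM; [exact: esum_cvg|exact: cvg_cst].
Qed.
End HermiteSeries.

(** * The Gaussian vector and its tensor powers *)

Section GaussVector.
Variables (R : realType) (d : nat).

Lemma gauss_vector_proof : (fun _ : 'I_d => @gauss R) \in @schwartz_pred R d.
Proof. by apply/asboolP => i; exact: gauss_schwartz. Qed.

Definition gauss_vector : schwartz R d := Schwartz gauss_vector_proof.

Lemma derive1n_scale_gauss (c : R) n :
  derive1n n (fun u => c * gauss u) = fun u => c * gauss_deriv n u.
Proof.
elim: n => // n IH; rewrite derive1nS IH; apply/funext => u.
rewrite derive1E; have h := is_derive_gauss_deriv n u.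
have -> : (fun v => c * gauss_deriv n v) = c *: gauss_deriv n by [].
by rewrite deriveZ //=; have [_ ->] := h.
Qed.

(** The Gaussian is the ground state of the harmonic oscillator: A phi = 2 phi. *)
Lemma opA_gauss p :
  iter p (@opA R d) (fun _ => @gauss R) = fun _ u => 2 ^+ p * gauss u.
Proof.
elim: p => [|p IH]; first by apply/funext => i; apply/funext => u; rewrite expr0 mul1r.
rewrite iterS IH; apply/funext => i; apply/funext => u.
rewrite /opA derive1n_scale_gauss gauss_derivSS /= (exprS _ p); ring.
Qed.

Lemma sqr_gauss (u : R) : gauss u ^+ 2 = gauss_fun u.
Proof. by rewrite /gauss /gauss_fun -expRM_natl; congr expR; field. Qed.

Lemma sqnorm_scale_gauss (s : R) :
  sqnorm (s *: gauss_vector) = s ^+ 2 * sqnorm gauss_vector.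
Proof.
rewrite /sqnorm mulr_sumr; apply: eq_bigr => i _.
rewrite -RintegralZl //.
  by apply: eq_Rintegral => u _; rewrite -exprMn.
have -> : EFin \o (fun x => gauss_vector i x ^+ 2) = EFin \o @gauss_fun R.
  by apply/funext => u /=; rewrite sqr_gauss.
exact: integrableT_gauss.
Qed.

Lemma sqnorm_ge0 (phi : schwartz R d) : 0 <= sqnorm phi.
Proof.
by apply: sumr_ge0 => i _; apply: Rintegral_ge0 => u _; exact: sqr_ge0.
Qed.

Lemma finite_kernel_gauss p n (c : R) j (u : n.-tuple R) :
  finite_kernel p [:: (c%:C%C, gauss_vector)] j u =
  (c * \prod_(k < n) (2 ^+ p * gauss (tnth u k)))%:C%C.
Proof.
rewrite /finite_kernel big_seq1 /= rmorphM; congr (_ * _); congr (_%:C)%C.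
by apply: eq_bigr => k _; rewrite opA_gauss.
Qed.

End GaussVector.

Section Kernels.
Variable R : realType.
Local Open Scope ereal_scope.

Lemma iter_integral0 n : iter_integral (fun _ : n.-tuple R => 0) = 0.
Proof. by elim: n => //= n IH; rewrite integral0_eq // => x _; rewrite IH. Qed.

Lemma iter_integral_prod (h : R -> R) (I K : R) n :
  lebesgue_measure.-integrable setT (EFin \o h) ->
  \int[lebesgue_measure]_x (h x)%:E = I%:E ->
  iter_integral (fun u : n.-tuple R => (K * \prod_(k < n) h (tnth u k))%:E) =
  (K * I ^+ n)%:E.
Proof.
move=> hint hI; elim: n K => [|n IH] K /=; first by rewrite big_ord0 expr0.
have E x : iter_integral (fun u : n.-tuple R =>
    (K * \prod_(k < n.+1) h (tnth [tuple of x :: u] k))%:E) =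
    (K * I ^+ n)%:E * (h x)%:E.
  rewrite -EFinM [(K * _ * _)%R]mulrAC -IH; congr iter_integral.
  apply/funext => u; rewrite big_ord_recl tnth0 mulrA; congr (_ * _)%:E.
  by apply: eq_bigr => k _; rewrite tnthS.
under eq_integral do rewrite E.
by rewrite integralZl // hI -EFinM exprSr mulrA.
Qed.

Lemma kernel_sqnorm_diff d n (F : kernel R d n) :
  kernel_sqnorm (fun j u => F j u - F j u)%R = 0.
Proof.
rewrite /kernel_sqnorm big1 // => j _; rewrite -[RHS](iter_integral0 n).
by congr iter_integral; apply/funext => u; rewrite subrr /csqr /= expr0n /= addr0.
Qed.

Lemma kernel_sqnorm_gauss d p n (c : R) :
  kernel_sqnorm (finite_kernel p [:: (c%:C%C, gauss_vector R d)] : kernel R d n) =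
  (c ^+ 2 * (d%:R * (4 ^+ p * Num.sqrt pi)) ^+ n)%:E.
Proof.
rewrite /kernel_sqnorm.
have E j : iter_integral (fun u : n.-tuple R =>
    (csqr (finite_kernel p [:: (c%:C%C, gauss_vector R d)] j u))%:E) =
    (c ^+ 2 * (4 ^+ p * Num.sqrt pi) ^+ n)%:E.
  rewrite -(iter_integral_prod (h := fun u => 4 ^+ p * gauss_fun u)%R).
  - congr iter_integral; apply/funext => u; rewrite finite_kernel_gauss.
    rewrite /csqr /= [(0 ^+ 2)%R]expr0n /= addr0 exprMn -prodrXl; congr (_ * _)%:E.
    apply: eq_bigr => k _; rewrite exprMn sqr_gauss -exprM mulnC exprM.
    by congr (_ ^+ _ * _)%R; rewrite -natrX.
  - exact: (integrableZl measurableT _ integrableT_gauss).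
  - under eq_integral do rewrite EFinM.
    by rewrite integralZl ?integralT_gauss //; exact: integrableT_gauss.
under eq_bigr do rewrite E.
rewrite sumEFin sumr_const card_tuple card_ord [((d%:R * _) ^+ n)%R]exprMn.
by rewrite -[(_ *+ d ^ n)%R]mulr_natl natrX mulrCA.
Qed.

Lemma in_symL2_gauss d p n (c : R) :
  in_symL2 (finite_kernel p [:: (c%:C%C, gauss_vector R d)] : kernel R d n).
Proof.
split=> [j||s j u].
- split; under eq_fun do rewrite finite_kernel_gauss /=; last exact: measurable_cst.
  apply: measurable_funM => //; apply: measurable_prod => k _.
  apply: measurable_funM => //.
  apply: (measurableT_comp (f := @gauss R)); last exact: measurable_tnth.
  apply: measurableT_comp; first exact: measurable_expR.
  apply: measurableT_comp => //; apply: measurable_funM => //.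
- by rewrite kernel_sqnorm_gauss ltry.
- rewrite !finite_kernel_gauss; congr (_ * _)%:C%C.
  rewrite [RHS](reindex_inj (@perm_inj _ s)) /=.
  by apply: eq_bigr => k _; rewrite tnth_mktuple.
Qed.

Lemma is_opA_image_gauss d p n (c : R) :
  is_opA_image p (finite_kernel 0 [:: (c%:C%C, gauss_vector R d)] : kernel R d n)
   (finite_kernel p [:: (c%:C%C, gauss_vector R d)]).
Proof.
split; first exact: in_symL2_gauss.
exists (fun=> [:: (c%:C%C, gauss_vector R d)]).
by split; under eq_fun do rewrite kernel_sqnorm_diff; exact: cvg_cst.
Qed.

Lemma exp_nneseries_lty (y : R) : (0 <= y)%R ->
  \sum_(0 <= n <oo) (y ^+ n / n`!%:R)%:E < +oo.
Proof.
move=> y0; apply: (@le_lt_trans _ _ (expR y)%:E); last exact: ltry.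
have t0 n : 0 <= (y ^+ n / n`!%:R)%:E by rewrite lee_fin divr_ge0 ?exprn_ge0.
apply: lime_le; first by apply: is_cvg_nneseries => n _ _.
apply: nearW => N; rewrite sumEFin lee_fin big_mkord; exact: exp_sum_le.
Qed.

End Kernels.

(** * The normalized exponential of the Gaussian vector is a test function *)

Section WhiteNoise.
Variables (R : realType) (d : nat).
Variable mu : probability (white_noise_space R d) R.
Hypothesis mu_white_noise : is_white_noise_measure mu.

Lemma measurable_pairing (phi : schwartz R d) :
  measurable_fun setT (fun w : white_noise_space R d => w phi : R).
Proof.
move=> _ B mB; rewrite setTI; apply: sub_sigma_algebra.
by exists phi, B.
Qed.

Let gv : schwartz R d := gauss_vector R d.
Let X (w : white_noise_space R d) : R := w gv.
Let y : R := - (sqnorm gv / 2).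

Let mX : measurable_fun setT X. Proof. exact: measurable_pairing. Qed.

(** The white noise measure gives the characteristic function of <w, phi>
    through its values at all multiples s phi. *)
Lemma pairing_gauss_exp_moment (a : R) :
  mu.-integrable setT (fun w => (expR (a * `|X w|))%:E).
Proof.
apply: (@exp_moment _ _ _ mu X mX (Num.sqrt (sqnorm gv))) => s.
have [<- _] : \int[mu]_w cos (w (s *: gv)) = gauss (Num.sqrt (sqnorm gv) * s) /\ True.
  have [-> _] := mu_white_noise (s *: gv); split => //.
  rewrite /gauss sqnorm_scale_gauss exprMn sqr_sqrtr ?sqnorm_ge0 //.
  by rewrite [s ^+ 2 * _]mulrC.
by apply: eq_Rintegral => w _; rewrite /X linearZ.
Qed.

Let dominant := fun w => (expR `|y| * expR `|X w|) ^+ 2.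

Let dominant_integrable (K : R) : mu.-integrable setT (fun w => (K * dominant w)%:E).
Proof.
have -> : (fun w => (K * dominant w)%:E) =
    (fun w => (K * expR `|y| ^+ 2)%:E * (expR (2 * `|X w|))%:E)%E.
  by apply/funext => w; rewrite /dominant exprMn -EFinM mulrA (expRM_natl 2).
exact: (integrableZl measurableT _ (pairing_gauss_exp_moment 2)).
Qed.

Let in_L2_dominated (f : white_noise_space R d -> R) (K : R) :
  measurable_fun setT f -> (forall w, `|f w| ^+ 2 <= K * dominant w) ->
  in_L2 mu (fun w => (f w)%:C%C).
Proof.
move=> mf fK; split; first by split => //; exact: measurable_cst.
have msq : measurable_fun setT (fun w => (f w ^+ 2)%:E).
  by apply/measurable_EFinP; exact: measurable_funX.
rewrite /L2_sqnorm; under eq_integral do rewrite /csqr /= [0 ^+ 2]expr0n addr0.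
have /integrableP[mD] := dominant_integrable K; apply: le_lt_trans.
apply: ge0_le_integral => //.
- by move=> w _; rewrite lee_fin sqr_ge0.
- exact: measurableT_comp.
- move=> w _; rewrite /= lee_fin -real_normK ?num_real //.
  by rewrite (le_trans (fK w)) // ler_norm.
Qed.

Let wick_seq n : seq (R[i] * schwartz R d) := [:: ((n`!%:R^-1)%:C%C, gv)].

Lemma finite_wick_gauss n w :
  finite_wick n (wick_seq n) w = (hermite_term n y (X w))%:C%C.
Proof.
rewrite /finite_wick big_seq1 /= -rmorphM; congr (_%:C)%C.
rewrite /wick_power /hermite_term mulr_sumr; apply: eq_bigr => k _.
have f0 m : (m`!%:R : R) != 0 by rewrite pnatr_eq0 -lt0n fact_gt0.
by rewrite -/y -/(X w); field; rewrite !f0.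
Qed.

Let measurable_hermite n : measurable_fun setT (fun w => hermite_term n y (X w)).
Proof.
apply: measurable_sum => k; apply: measurable_funM => //; apply: measurable_funM => //.
exact: measurable_funX.
Qed.

Let hermite_dominated n w : `|hermite_term n y (X w)| ^+ 2 <= 4 * dominant w.
Proof.
have -> : 4 * dominant w = (2 * (expR `|y| * expR `|X w|)) ^+ 2.
  by rewrite exprMn -natrX.
rewrite lerXn2r ?nnegrE ?mulr_ge0 ?expR_ge0 //.
have -> : hermite_term n y (X w) = \sum_(k < n.+1) hermite_term k y (X w) -
    \sum_(k < n) hermite_term k y (X w) by rewrite big_ord_recr /= addrAC subrr add0r.
by rewrite (le_trans (ler_normB _ _)) // mulr_natl mulr2n lerD ?hermite_sum_bound.
Qed.

Let error N w := expR y * expR (X w) - \sum_(n < N) hermite_term n y (X w).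

Let measurable_error N : measurable_fun setT (error N).
Proof.
apply: measurable_funB; last by apply: measurable_sum => k; exact: measurable_hermite.
by apply: measurable_funM => //; apply: measurableT_comp => //; exact: measurable_expR.
Qed.

Let wick_expE w : wick_exp gv w = (expR y * expR (X w))%:C%C.
Proof. by rewrite /wick_exp addrC expRD. Qed.

Let exp_dominated w : `|expR y * expR (X w)| <= expR `|y| * expR `|X w|.
Proof.
rewrite ger0_norm ?mulr_ge0 ?expR_ge0 //.
by rewrite ler_pM ?expR_ge0 // ler_expR ler_norm.
Qed.

Lemma wick_exp_gauss_L2 : in_L2 mu (wick_exp gv).
Proof.
have -> : wick_exp gv = fun w => (expR y * expR (X w))%:C%C.
  by apply/funext => w; exact: wick_expE.
apply: (@in_L2_dominated _ 1).
  by apply: measurable_funM => //; apply: measurableT_comp => //; exact: measurable_expR.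
move=> w; rewrite mul1r lerXn2r ?nnegrE ?mulr_ge0 ?expR_ge0 //.
Qed.

(** The kernels are finite sums themselves, so each Wick pairing is reached by a
    constant sequence; only the L^2 convergence of the series needs an argument,
    dominated convergence. *)
Lemma wick_exp_gauss_chaos : chaos_decomposition mu (wick_exp gv)
  (fun n => finite_kernel 0 (wick_seq n)).
Proof.
split=> [n|]; first exact: in_symL2_gauss.
exists (fun n => finite_wick n (wick_seq n)); split=> [n|].
  split.
    rewrite (_ : finite_wick n _ = fun w => (hermite_term n y (X w))%:C%C); last first.
      by apply/funext => w; rewrite finite_wick_gauss.
    exact: (@in_L2_dominated _ 4).
  exists (fun=> wick_seq n); split.
    by under eq_fun do rewrite kernel_sqnorm_diff; exact: cvg_cst.
  have -> : (fun m : nat => L2_sqnorm mu (fun w =>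
      finite_wick n (wick_seq n) w - finite_wick n (wick_seq n) w)) = fun=> 0%E.
    apply/funext => m; rewrite /L2_sqnorm integral0_eq // => w _.
    by rewrite subrr /csqr /= expr0n /= addr0.
  exact: cvg_cst.
have E N : L2_sqnorm mu (fun w => wick_exp gv w - \sum_(n < N) finite_wick n (wick_seq n) w) =
    (\int[mu]_w (error N w ^+ 2)%:E)%E.
  apply: eq_integral => w _; rewrite wick_expE.
  under eq_bigr do rewrite finite_wick_gauss.
  by rewrite -rmorph_sum -rmorphB /csqr /= [0 ^+ 2]expr0n addr0.
under eq_fun do rewrite E.
have [|||||_ _] := @dominated_convergence _ _ _ mu _ measurableT
  (fun N w => (error N w ^+ 2)%:E) (cst 0%E) (fun w => (4 * dominant w)%:E).
- by move=> N; apply/measurable_EFinP; exact: measurable_funX.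
- exact: measurable_cst.
- apply: aeW => w _; apply: cvg_EFin; first exact: nearW.
  suff : error N w ^+ 2 @[N --> \oo] --> ((0 : R) ^+ 2) by rewrite expr0n.
  apply: (@cvg_comp _ _ _ (fun N => error N w) (fun z : R => z ^+ 2)); last exact: exprn_continuous.
  rewrite -(subrr (expR y * expR (X w))).
  by apply: cvgB; [exact: cvg_cst|exact: hermite_sum_cvg].
- exact: dominant_integrable.
- apply: aeW => w N _; rewrite /= lee_fin ger0_norm ?sqr_ge0 //.
  have -> : 4 * dominant w = (2 * (expR `|y| * expR `|X w|)) ^+ 2.
    by rewrite exprMn -natrX.
  rewrite -real_normK ?num_real // lerXn2r ?nnegrE ?mulr_ge0 ?expR_ge0 //.
  rewrite (le_trans (ler_normB _ _)) // mulr_natl mulr2n lerD ?hermite_sum_bound //.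
by rewrite integral0.
Qed.

Lemma hida_sqnorm_wick_exp_gauss p : (hida_sqnorm mu p (wick_exp gv) < +oo)%E.
Proof.
pose Y : R := d%:R * (4 ^+ p * Num.sqrt pi).
have Y0 : 0 <= Y by rewrite mulr_ge0 // mulr_ge0 ?exprn_ge0 ?sqrtr_ge0.
apply: le_lt_trans (exp_nneseries_lty Y0); apply: ereal_inf_lbound.
exists (fun n => finite_kernel 0 (wick_seq n)), (fun n => finite_kernel p (wick_seq n)).
split=> [|n|]; first exact: wick_exp_gauss_chaos.
  exact: is_opA_image_gauss.
apply: eq_eseriesr => n _; rewrite kernel_sqnorm_gauss -EFinM; congr (_%:E).
have f0 : (n`!%:R : R) != 0 by rewrite pnatr_eq0 -lt0n fact_gt0.
by rewrite -/Y; field.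
Qed.

Lemma hida_test_wick_exp_gauss : hida_test mu (wick_exp gv).
Proof. by split; [exact: wick_exp_gauss_L2|exact: hida_sqnorm_wick_exp_gauss]. Qed.

Lemma hida_bounded_wick_exp_gauss : hida_bounded mu [set wick_exp gv].
Proof.
split=> [_ -> |p]; first exact: hida_test_wick_exp_gauss.
have := hida_sqnorm_wick_exp_gauss p; case E : hida_sqnorm => [r| |] // _.
- by exists r => _ ->; rewrite E.
- by exists 0 => _ ->; rewrite E leNye.
Qed.

End WhiteNoise.

(** * Divergence of the integral of the inverse *)

Section LowerIntegral.
Import HBNNSimple.
Context (dsp : measure_display) (T : measurableType dsp) (R : realType).
Context (mu : {measure set T -> \bar R}).
Local Open Scope ereal_scope.

(** The integral of a nonnegative function is the supremum over the simple
    functions below it, so it is monotone without any measurability.  This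
    matters because the distance between a simple function and a Bochner
    integrable one is measurable only up to a null set. *)
Lemma le_integral_nonmeasurable (D E : set T) (h f : T -> \bar R) :
  D `<=` E -> (forall x, D x -> 0 <= h x) -> (forall x, E x -> 0 <= f x) ->
  (forall x, D x -> h x <= f x) ->
  \int[mu]_(x in D) h x <= \int[mu]_(x in E) f x.
Proof.
move=> DE h0 f0 hf; rewrite !ge0_integralE //.
apply: ereal_sup_le => _ [s /= sh <-]; exists s => //= x; apply: (le_trans (sh x)); rewrite !patchE.
case: ifPn => [/[!inE] Dx|_].
  by rewrite mem_set ?hf //; exact: DE.
by case: ifPn => // /[!inE]; exact: f0.
Qed.

End LowerIntegral.

Section InverseIntegral.
Variable R : realType.
Local Notation nu := (@lebesgue_measure R).

Lemma measurable_inv_pos (D : set R) : D `<=` [set t | 0 < t] ->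
  measurable_fun D (fun t : R => (t^-1)%:E).
Proof.
move=> D0; apply/measurable_EFinP.
apply: (eq_measurable_fun (fun t : R => t `^ (-1))) => [t /[!inE] Dt|].
  by rewrite powR_inv1 // ltW //; exact: D0.
by apply: measurable_funTS; exact: measurable_powR.
Qed.

(** On each of the n dyadic intervals ]b/2, b] the integrand is at least 1/b. *)
Lemma integral_inv_dyadic (a : R) n : 0 < a ->
  ((n%:R / 2)%:E <= \int[nu]_(t in `](a / 2 ^+ n)%R, a]) (t^-1)%:E)%E.
Proof.
move=> a0; elim: n => [|n IH].
  rewrite mul0r; apply: integral_ge0 => t /=; rewrite in_itv /= => /andP[+ _].
  by rewrite expr0 divr1 lee_fin invr_ge0 => at_; rewrite ltW // (lt_trans a0).
set b := a / 2 ^+ n; have b0 : 0 < b by rewrite divr_gt0 ?exprn_gt0.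
have bE : a / 2 ^+ n.+1 = b / 2 by rewrite exprSr invfM mulrA.
have ba : b <= a by rewrite ler_pdivrMr ?exprn_gt0 // ler_peMr ?(ltW a0) // exprn_ege1 // ler1n.
have bb : b / 2 <= b by rewrite ler_pdivrMr // ler_peMr ?(ltW b0) // ler1n.
have pos (t : R) : b / 2 < t -> (0 <= (t^-1)%:E)%E.
  by move=> h; rewrite lee_fin invr_ge0 ltW // (lt_trans _ h) // divr_gt0.
have -> : `](a / 2 ^+ n.+1), a]%classic = `](b / 2), b] `|` `]b, a].
  by rewrite bE -itv_bndbnd_setU // bnd_simp.
rewrite ge0_integral_setU //; last 3 first.
- by apply: measurable_inv_pos => t [] /=; rewrite in_itv /= => /andP[h _];
    rewrite (lt_trans _ h) // divr_gt0.
- by move=> t /= [] /=; rewrite in_itv /= => /andP[h _]; apply: pos => //;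
    exact: le_lt_trans h.
- apply/disj_setPS => t /= []; rewrite !in_itv /= => /andP[_ h1] /andP[h2 _].
  by have := lt_le_trans h2 h1; rewrite ltxx.
rewrite -natr1 mulrDl EFinD addeC leeD //.
apply: (@le_trans _ _ (\int[nu]_(t in `](b / 2)%R, b]) (b^-1)%:E)%E).
  rewrite integral_cst //= lebesgue_measure_itv /= lte_fin.
  rewrite ifT; last by rewrite ltr_pdivrMr // ltr_pMr // ltr1n.
  rewrite -EFinD -EFinM lee_fin.
  by rewrite le_eqVlt; apply/orP; left; apply/eqP; field; rewrite gt_eqF.
apply: ge0_le_integral => //.
- by move=> t _; rewrite lee_fin invr_ge0 ltW.
- by apply: measurable_inv_pos => t /=; rewrite in_itv /= => /andP[h _];
    rewrite (lt_trans _ h) // divr_gt0.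
- move=> t /=; rewrite in_itv /= => /andP[h1 h2]; rewrite lee_fin lef_pV2 ?posrE //.
  by rewrite (lt_trans _ h1) // divr_gt0.
Qed.

Lemma integral_inv_itv (a : R) : 0 < a -> (\int[nu]_(t in `]0%R, a]) (t^-1)%:E = +oo)%E.
Proof.
move=> a0; apply/eqyP => M M0.
pose n := (Num.trunc (M * 2)).+1.
have Mn : M <= n%:R / 2.
  by rewrite ler_pdivlMr // ltW // truncnS_gt.
apply: (@le_trans _ _ (n%:R / 2)%:E); first by rewrite lee_fin.
apply: le_trans (integral_inv_dyadic n a0) _.
have d0 : 0 < a / 2 ^+ n by rewrite divr_gt0 ?exprn_gt0.
apply: le_integral_nonmeasurable => [t /=|t /=|t /=|//]; rewrite !in_itv /=.
- by move=> /andP[h ->]; rewrite (lt_trans d0 h).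
- by move=> /andP[h _]; rewrite lee_fin invr_ge0 ltW // (lt_trans d0 h).
- by move=> /andP[h _]; rewrite lee_fin invr_ge0 ltW.
Qed.

End InverseIntegral.

(** * The integrand near time zero *)

(** For 2 pi t <= 1, the factor (2 pi t)^(-d/2) is at least (2 pi t)^(-1) since
    d >= 2.  As t <= 1 and |<eta_t, phi>|^2 <= d t^2, the two other factors are
    at least exp(-d/2) and exp(-1/2). *)
Lemma gauss_current_lower_bound (R : realType) (d : nat) (t : R) :
  (1 < d)%N -> 0 < t -> 2 * pi * t <= 1 ->
  expR (- (1 / 2)) * (2 * pi)^-1 * expR (- (d%:R / 2)) / t <=
  ((2 * pi * t) `^ (- (d%:R / 2)) *
     expR (- (eta_sqnorm t (gauss_vector R d) / (2 * t)))) * gauss t.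
Proof.
move=> d1 t0 pt.
have pi0 : 0 < 2 * pi :> R by rewrite mulr_gt0 ?pi_gt0.
have t1 : t <= 1.
  rewrite (le_trans _ pt) // ler_peMl ?(ltW t0) //.
  by have := pi_ge2 R; lra.
have g : expR (- (1 / 2)) <= gauss t.
  by rewrite /gauss ler_expR lerN2 ler_pM2r ?invr_gt0 // exprn_ile1 // ltW.
have p : (2 * pi * t)^-1 <= (2 * pi * t) `^ (- (d%:R / 2)).
  rewrite -powR_inv1 ?(ltW (mulr_gt0 pi0 t0)) //.
  apply: ger_powR; first by rewrite mulr_gt0.
  rewrite lerN2 ler_pdivlMr // mul1r.
  by rewrite (ler_nat R 2).
have e : expR (- (d%:R / 2)) <= expR (- (eta_sqnorm t (gauss_vector R d) / (2 * t))).
  rewrite ler_expR lerN2 ler_pdivrMr ?mulr_gt0 //.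
  have -> : d%:R / 2 * (2 * t) = \sum_(i < d) t.
    by rewrite sumr_const card_ord -mulr_natl; field.
  apply: ler_sum => i _.
  have ig : (@lebesgue_measure R).-integrable `[0, t[ (EFin \o @gauss R).
    apply: measurable_bounded_integrable => //.
    + by rewrite /= lebesgue_measure_itv /= lte_fin t0 -EFinB ltry.
    + apply: measurable_funTS; apply: measurableT_comp; first exact: measurable_expR.
      by apply: measurableT_comp => //; exact: measurable_funM.
    + by exists 1; split=> // x x1 y _ /=; rewrite ger0_norm ?gauss_ge0 //
        (le_trans (gauss_le1 _)) // ltW.
  have I0 : 0 <= \int[lebesgue_measure]_(u in `[0, t[) gauss u.
    by apply: Rintegral_ge0 => u _; exact: gauss_ge0.
  have It : \int[lebesgue_measure]_(u in `[0, t[) gauss u <= t.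
    apply: (@le_trans _ _ (\int[@lebesgue_measure R]_(u in `[0, t[) (1 : R))).
      apply: le_Rintegral => //; last by move=> u _; exact: gauss_le1.
      apply: measurable_bounded_integrable => //.
        by rewrite /= lebesgue_measure_itv /= lte_fin t0 -EFinB ltry.
      by exists 1; split=> // x x1 y _ /=; rewrite normr1 ltW.
    rewrite Rintegral_cst //= lebesgue_measure_itv /= lte_fin t0 /= subr0 mul1r //.
  rewrite expr2; apply: (le_trans (ler_pM I0 I0 It It)).
  by rewrite ler_piMl // ltW.
rewrite [leLHS](_ : _ = (2 * pi * t)^-1 * expR (- (d%:R / 2)) * expR (- (1 / 2))); last first.
  by rewrite (invfM (2 * pi)); ring.
have inv0 : 0 <= (2 * pi * t)^-1 by rewrite invr_ge0 ltW // mulr_gt0.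
apply: ler_pM => //; first by rewrite mulr_ge0 ?expR_ge0.
by apply: ler_pM => //; exact: expR_ge0.
Qed.

(** * Hilbert subspaces *)

Section HilbertFunctional.
Variables (R : realType) (H : lmodType R[i]) (L : H -> R[i]).
Hypothesis Llin : forall (a : R[i]) h k, L (a *: h + k) = a * L h + L k.

Lemma normC_real (z : R[i]) : `|z| = (complex.Re `|z|)%:C%C.
Proof. by rewrite normc_def. Qed.

Lemma functional0 : L 0 = 0.
Proof.
have := Llin 1 0 0; rewrite scaler0 add0r mul1r => /eqP.
by rewrite -subr_eq subrr eq_sym => /eqP.
Qed.

Lemma functionalB h k : L (h - k) = L h - L k.
Proof. by rewrite addrC -scaleN1r Llin mulN1r addrC. Qed.

Lemma functional_simple_bounded (s : R -> H) :
  simple_function s -> exists K : R, forall t, `|L (s t)| <= K%:C%C.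
Proof.
move=> [n [A [h [_ sE]]]].
exists (\sum_(k < n) complex.Re `|L (h k)|) => t; rewrite sE.
have -> : L (\sum_(k < n) (\1_(A k) t : R)%:C%C *: h k) =
    \sum_(k < n) (\1_(A k) t : R)%:C%C * L (h k).
  have LD x z : L (x + z) = L x + L z by rewrite -[x]scale1r Llin mul1r scale1r.
  rewrite (big_morph L LD functional0); apply: eq_bigr => k _.
  by rewrite -[_ *: _]addr0 Llin functional0 addr0.
rewrite rmorph_sum (le_trans (ler_norm_sum _ _ _)) //.
apply: ler_sum => k _; rewrite [leRHS](_ : _ = `|L (h k)|) ?normrM; last by rewrite [RHS]normC_real.
rewrite -[leRHS]mul1r ler_wpM2r // indicE.
by case: (_ \in _); rewrite ?normr1 ?normr0.
Qed.

End HilbertFunctional.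

(** One term s of an approximating sequence suffices: |L (s t)| <= K, so for
    t <= c / (2 K) at least half of c / t is left for |L (s t - g t)|, which is
    at most C times the norm of s t - g t. *)
Lemma not_bochner_integrable_of_inverse (R : realType) (H : lmodType R[i])
    (ip : {dot H for @Num.conj R[i]}) (L : H -> R[i]) (C T a c : R)
    (g : R -> H) :
  (forall (z : R[i]) h k, L (z *: h + k) = z * L h + L k) ->
  (forall h, `|L h| <= (C * hilbert_norm ip h)%:C%C) ->
  0 < a <= T -> 0 < c ->
  {ae lebesgue_measure, forall t : R, 0 < t <= a -> ((c / t)%:C%C <= `|L (g t)|)} ->
  ~ bochner_integrable ip T g.
Proof.
move=> Llin Lbound /andP[a0 aT] c0 [N [mN N0 subN]] [s [ssimple _ s0]].
have [m mfin] : exists m, (\int[lebesgue_measure]_(t in `]0%R, T])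
    (hilbert_norm ip (s m t - g t))%:E)%E \is a fin_num.
  by have /fine_cvgP[[m _ mfin] _] := s0; exists m; apply: mfin => /=.
have [K LK] := functional_simple_bounded Llin (ssimple m).
(* The given bounds K and C need not be positive. *)
pose C1 := Num.max C 1.
have C1_gt0 : 0 < C1 by rewrite lt_max ltr01 orbT.
pose K1 := Num.max K 1.
have K1_gt0 : 0 < K1 by rewrite lt_max ltr01 orbT.
pose b := Num.min a (c / (2 * K1)).
have b0 : 0 < b by rewrite lt_min a0 divr_gt0 ?mulr_gt0.
have key t : (`]0, b] `\` N) t ->
    c / (2 * C1) * t^-1 <= hilbert_norm ip (s m t - g t).
  move=> [] /=; rewrite in_itv /= => /andP[t0 tb] Nt.
  have ta : 0 < t <= a by rewrite t0 (le_trans tb) // ge_min lexx.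
  have lower : (c / t)%:C%C <= `|L (g t)|.
    by apply: contrapT => h; apply: Nt; apply: subN => /= /(_ ta).
  have n0 : 0 <= hilbert_norm ip (s m t - g t) by exact: sqrtr_ge0.
  have upper : c / t <= K + C * hilbert_norm ip (s m t - g t).
    rewrite -lecR (le_trans lower) // rmorphD.
    have -> : L (g t) = L (s m t) - L (s m t - g t).
      by rewrite (functionalB Llin) opprB addrC subrK.
    by rewrite (le_trans (ler_normB _ _)) // lerD.
  have CC1 : C * hilbert_norm ip (s m t - g t) <= C1 * hilbert_norm ip (s m t - g t).
    by rewrite ler_wpM2r // le_max lexx.
  have KK1 : K <= c / t / 2.
    rewrite (@le_trans _ _ K1) ?le_max ?lexx //.
    rewrite ler_pdivlMr // ler_pdivlMr // -ler_pdivlMl ?mulr_gt0 //.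
    by rewrite mulrC [K1 * 2]mulrC (le_trans tb) // ge_min lexx orbT.
  have -> : c / (2 * C1) * t^-1 = (c / t / 2) / C1 by field; rewrite !gt_eqF.
  rewrite ler_pdivrMr // mulrC; lra.
have : (\int[lebesgue_measure]_(t in `]0%R, b] `\` N) (c / (2 * C1) * t^-1)%:E <=
    \int[lebesgue_measure]_(t in `]0%R, T]) (hilbert_norm ip (s m t - g t))%:E)%E.
  apply: le_integral_nonmeasurable.
  - move=> t [] /=; rewrite !in_itv /= => /andP[-> tb] _.
    by rewrite (le_trans tb) // ge_min aT.
  - move=> t [] /=; rewrite in_itv /= => /andP[t0 _] _.
    by rewrite lee_fin mulr_ge0 ?divr_ge0 ?mulr_ge0 ?invr_ge0 ?ltW.
  - by move=> t _; rewrite lee_fin sqrtr_ge0.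
  - by move=> t /key; rewrite lee_fin.
have k0 : 0 < c / (2 * C1) by rewrite divr_gt0 ?mulr_gt0.
have pos (t : R) : `]0, b]%classic t -> (0 <= (t^-1)%:E)%E.
  by rewrite /= in_itv /= => /andP[t0 _]; rewrite lee_fin invr_ge0 ltW.
have mI : measurable_fun `]0, b]%classic (fun t : R => (t^-1)%:E).
  by apply: measurable_inv_pos => t /=; rewrite in_itv /= => /andP[].
under eq_integral do rewrite EFinM.
have pos_scaled (t : R) : `]0, b]%classic t -> (0 <= (c / (2 * C1))%:E * (t^-1)%:E)%E.
  by move=> /pos; apply: mule_ge0; rewrite lee_fin ltW.
have mI_scaled := measurable_funeM (c / (2 * C1))%:E mI.
have <- := ge0_negligible_integral mN (measurable_itv _) mI_scaled pos_scaled N0.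
rewrite ge0_integralZl_EFin ?(ltW k0) // integral_inv_itv // gt0_muley ?lte_fin //.
by rewrite leye_eq => /eqP E; rewrite E in mfin.
Qed.

(** * The stochastic current at the origin *)

Theorem mainTheorem3 (R : realType) (d : nat) (d_gt1 : (1 < d)%N)
    (T : R) (T_gt0 : 0 < T)
    (mu : probability (white_noise_space R d) R)
    (mu_white_noise : is_white_noise_measure mu)
    (delta : R -> hida_distribution mu)
    (delta_donsker : forall t : R, 0 < t -> is_donsker_delta t (delta t))
    (W : 'I_d -> R -> hida_distribution mu)
    (W_white_noise : forall (i : 'I_d) (t : R), 0 <= t ->
      is_white_noise i t (W i t))
    (X : 'I_d -> R -> hida_distribution mu)
    (X_wick : forall (i : 'I_d) (t : R), 0 < t ->
      is_wick_product (delta t) (W i t) (X i t)) :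
  ~ (forall i : 'I_d, bochner_integral_exists T (X i)).
Proof.
pose i : 'I_d := Ordinal (ltnW d_gt1).
move=> /(_ i) [H [ip [j [[_ jlin _ jbounded] [g [gint gX]]]]]].
have F_test := hida_test_wick_exp_gauss mu_white_noise.
have [C jC] := jbounded _ (hida_bounded_wick_exp_gauss mu_white_noise).
pose F := wick_exp (gauss_vector R d).
have pi0 : 0 < 2 * pi :> R by rewrite mulr_gt0 ?pi_gt0.
pose a : R := Num.min T (2 * pi)^-1.
have a0 : 0 < a by rewrite lt_min T_gt0 invr_gt0.
pose c : R := expR (- (1 / 2)) * (2 * pi)^-1 * expR (- (d%:R / 2)).
apply: (@not_bochner_integrable_of_inverse R H ip (fun h => j h F) C T a c g) gint.
- by move=> z h k; apply: jlin.
- by move=> h; apply: jC.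
- by rewrite a0 ge_min lexx.
- by rewrite !mulr_gt0 ?expR_gt0 ?invr_gt0.
case: gX => N [mN N0 subN]; exists N; split=> //; apply: subset_trans subN.
apply: subsetC => t /= gX /andP[t0 ta].
have tT : 0 < t <= T by rewrite t0 (le_trans ta) // ge_min lexx.
rewrite (gX tT _ F_test) -[X i t _]/(S_transform (X i t) (gauss_vector R d)).
rewrite X_wick // delta_donsker // W_white_noise ?(ltW t0) // -rmorphM.
have tpi : 2 * pi * t <= 1.
  by rewrite -ler_pdivlMl // mulr1 (le_trans ta) // ge_min lexx orbT.
apply: le_trans (_ : _ <= (_ : R)%:C%C) _; first by rewrite lecR; exact: gauss_current_lower_bound.
by rewrite normc_def /= lecR expr0n addr0 sqrtr_sqr ler_norm.
Qed.
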